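(* Let $h:V\to\mathbb R$ be a continuous integrand and let $s>0$ be a positive number satisfying $$J_{\frac n2}(2\pi s|m|)\ne0\quad\text{for all }m\in\mathbb Z^n\cap\mathscr V_{\mathcal A}.$$ Then $h$ is $\mathcal A$-quasiconvex if and only if $h$ is $\mathscr A_s$-quasiconvex.
   Context: $V,W$ are finite-dimensional inner product spaces, $A_1,\dots,A_n\in\mathrm{Hom}(V,W)$, $\mathcal A=\sum_{i=1}^nA_i\partial_i$ acts on $V$-valued maps on $\mathbb R^n$, its symbol is $\mathbb A(\xi)=\sum_iA_i\xi_i$, and $\mathscr V_{\mathcal A}=\{\zeta\in\mathbb R^n:\mathrm{rank}\,\mathbb A(\zeta)>0\}$. $J_{n/2}$ is the Bessel function of the first kind of order $n/2$. Spherical operator: for smooth $u:\mathbb R^n\to V$ and $s>0$, $$\mathscr A_su(x)=n\,\frac{1}{\mathcal H^{n-1}(\partial B_s)}\int_{\partial B_s}\mathbb A\left(\frac{\omega}{s}\right)\left[\frac{u(x+\omega)-u(x)}{s}\right]dS(\omega),$$ where $S=\mathcal H^{n-1}$ on the sphere $\partial B_s$ of radius $s$ about $0$. Quasiconvexity: let $Q=[0,1)^n$ and let $\mathscr D_\sharp(\mathbb T^n;V)$ be the space of smooth maps $u:\mathbb R^n\to V$ that are $Q$-periodic and have zero mean, $\int_Qu=0$. For $A\in\{\mathcal A,\mathscr A_s\}$, a continuous integrand $h:V\to\mathbb R$ is called $A$-quasiconvex if for all $v\in V$, $h(v)\le\int_Qh(u(x)+v)\,dx$ for all $u\in\mathscr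 D_\sharp(\mathbb T^n;V)$ satisfying $Au=0$. *)

(* Defs.v *)
From HB Require Import structures.
From mathcomp Require Import all_boot all_order all_algebra.
From mathcomp Require Import all_classical all_reals all_analysis.

Set Implicit Arguments.
Unset Strict Implicit.
Unset Printing Implicit Defensive.

Import Order.TTheory GRing.Theory Num.Theory.
Import numFieldNormedType.Exports.

Local Open Scope classical_set_scope.
Local Open Scope ring_scope.

(* Finite-dimensional real inner product spaces, whose norm (hence topology)
   is the one of the inner product *)
HB.mixin Record hasInnerProduct (R : realType) V
    of Vector R V & NormedModule R V := {
  inner : {dot V for idfun} ;
  sqr_norm_inner : forall v : V, `|v| ^+ 2 = inner v v
}.

#[short(type="innerProductType")]
HB.structure Definition InnerProduct (R : realType) :=
  { V of Vector R V & NormedModule R V & hasInnerProduct R V }.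

Section cover_measure.
Context (T : Type) (R : realType) (J : Type).
Variables (C : set J) (S : J -> set T) (w : J -> \bar R).
Hypothesis w_ge0 : forall j, C j -> (0 <= w j)%E.
Local Open Scope ereal_scope.

(* The index None stands for the empty set with weight 0, so that finite
   covers are covers. *)
Definition cover_of (X : set T) : set (nat -> option J) :=
  [set F | (forall k j, F k = Some j -> C j) /\
           X `<=` \bigcup_k oapp S set0 (F k)].

Definition cover_measure (X : set T) : \bar R :=
  ereal_inf [set \sum_(k <oo) oapp w 0 (F k) | F in cover_of X].

Let ow_ge0 X F : cover_of X F -> forall k, 0 <= oapp w 0 (F k).
Proof. by move=> [CF _] k; case E : (F k) => [j|] //=; exact/w_ge0/CF/E. Qed.

Lemma cover_measure_ge0 X : 0 <= cover_measure X.
Proof.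
apply: le_ereal_inf_tmp => _ [F XF <-]; apply: nneseries_ge0 => k _ _.
exact: ow_ge0 XF k.
Qed.

Lemma cover_measure0 : cover_measure set0 = 0.
Proof.
apply/eqP; rewrite eq_le cover_measure_ge0 andbT.
apply: ereal_inf_lbound; exists (fun=> None); first by split.
by apply: lim_near_cst => //; near=> n => /=; rewrite big1.
Unshelve. all: by end_near. Qed.

Lemma le_cover_measure : {homo cover_measure : A B / A `<=` B >-> A <= B}.
Proof.
move=> A B AB; apply/ereal_inf_le_tmp => x [F [CF BF]].
by move=> <-{x}; exists F => //; split => //; apply: subset_trans AB BF.
Qed.

Lemma cover_measure_sigma_subadditive : sigma_subadditive cover_measure.
Proof.
move=> A; have [[i ioo]|] := pselect (exists i, cover_measure (A i) = +oo).
  rewrite (eseries_pinfty _ _ ioo) ?leey// => n _.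
  by rewrite -ltNye (lt_le_trans _ (cover_measure_ge0 _)).
rewrite -forallNE => Aoo.
suff add2e (e : {posnum R}) :
    cover_measure (\bigcup_n A n) <=
    \sum_(i <oo) cover_measure (A i) + e%:num%:E.
  by apply/lee_addgt0Pr => _/posnumP[].
rewrite (le_trans _ (epsilon_trick _ _ _))//; last first.
  by move=> n; exact: cover_measure_ge0.
pose P n B := cover_of (A n) B /\
  \sum_(k <oo) oapp w 0 (B k) <=
    cover_measure (A n) + (e%:num / (2 ^ n.+1)%:R)%:E.
have [G PG] : {G : nat -> nat -> option J & forall n, P n (G n)}.
  apply: (@choice _ _ P) => n; rewrite /P /cover_measure.
  set U := (X in ereal_inf X); move infU : (ereal_inf U) => iU.
  case: iU infU => [r Ur|Uoo|Uoo].
  - have en1 : (0 < e%:num / (2 ^ n.+1)%:R)%R by [].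
    have /(lb_ereal_inf_adherent en1) : ereal_inf U \is a fin_num by rewrite Ur.
    move=> [x [B AB muBx] xU].
    by exists B; split => //; rewrite muBx -Ur; exact/ltW.
  - by have := Aoo n; rewrite /cover_measure Uoo.
  - suff : lbound U 0 by move/le_ereal_inf_tmp; rewrite Uoo.
    by move=> /= _ [B AB <-]; apply: nneseries_ge0 => k _ _; exact: ow_ge0 AB k.
pose g (x : nat * nat) := oapp w 0 (uncurry G x).
have g_ge0 x : 0 <= g x by case: x => a b; exact: (ow_ge0 (PG a).1 b).
apply: (@le_trans _ _ (\esum_(i in setT) g i)).
  rewrite /cover_measure; apply: ereal_inf_lbound => /=.
  have /card_esym/ppcard_eqP[f] := card_nat2.
  exists (uncurry G \o f).
    split => [k j|]; first by rewrite /=; case: (f k) => a b; exact: (PG a).1.1.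
    apply: (@subset_trans _  (\bigcup_n \bigcup_k oapp S set0 (G n k))) => [t [i _]|].
      by move=> /((PG i).1.2) -[j _ ?]; exists i => //; exists j.
    move=> t [i _ [j _ Bijt]]; exists (f^-1%FUN (i, j)) => //=.
    by rewrite invK ?inE.
  rewrite -(esum_pred_image g _ xpredT) ?[fun=> _]set_true//.
  by rewrite image_eq.
rewrite (_ : esum _ _ = \sum_(i <oo) \sum_(j <oo ) oapp w 0 (G i j)); last first.
  pose K : nat -> set (nat * nat) := fun i => [set (i, j) | j in setT].
  rewrite (_ : setT = \bigcup_k K k); last first.
    by rewrite predeqE => -[a b]; split => // _; exists a => //; exists b.
  rewrite esum_bigcupT /=; last 2 first.
    - apply/trivIsetP => i j _ _ ij.
      rewrite predeqE => -[n m] /=; split => //= -[] [_] _ [<-{n} _].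
      by move=> [m' _] [] /esym/eqP; rewrite (negbTE ij).
    - by move=> /= x; exact: g_ge0.
  rewrite -(image_id [set: nat]) -fun_true esum_pred_image//; last first.
    by move=> n _; exact: esum_ge0.
  apply: eq_eseriesr => /= j _.
  rewrite -(esum_pred_image g (pair j) predT)//=; last first.
    by move=> ? ? _ _; exact: (@can_inj _ _ _ snd).
  by congr esum; rewrite predeqE => -[a b]; split; move=> [i _ <-]; exists i.
apply: lee_lim.
- apply: is_cvg_nneseries => n *.
  by apply: nneseries_ge0 => m *; exact: (g_ge0 (n, m)).
- by apply: is_cvg_nneseries => n *; apply: adde_ge0 => //; exact: cover_measure_ge0.
- by near=> n; apply: lee_sum => i _; exact: (PG i).2.
Unshelve. all: by end_near. Qed.

End cover_measure.

Section special_functions.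
Context {R : realType}.

Definition Gamma (x : R) : R :=
  \int[lebesgue_measure]_(t in `]0, +oo[) (t `^ (x - 1) * expR (- t)).

(* Meaningful for nu >= 0 and z >= 0 only: a `^ x is a real power of a >= 0. *)
Definition besselJ (nu z : R) : R :=
  limn (series (fun k : nat =>
    (-1) ^+ k / (k`!%:R * Gamma (k%:R + nu + 1)) *
    (z / 2) `^ (k.*2%:R + nu))).

End special_functions.

Section euclidean_space.
Context {R : realType}.

(* The norm `|x| of the library on 'rV[R]_n is the sup norm. *)
Definition enorm n (x : 'rV[R]_n) : R := Num.sqrt (\sum_i x 0 i ^+ 2).

Definition diam n (U : set 'rV[R]_n) : \bar R :=
  ereal_sup [set (enorm (x - y))%:E | x in U & y in U].

(* Volume of the unit ball of R^k, the usual normalisation of H^k *)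
Definition ball_volume (k : nat) : R :=
  pi `^ (k%:R / 2) / Gamma (k%:R / 2 + 1).

(* The weight of a nonempty set; it also gives set0 a nonnegative weight, which
   is harmless since covers may use None instead. *)
Definition hausdorff_weight n k (U : set 'rV[R]_n) : \bar R :=
  (ball_volume k * (fine (diam U) / 2) ^+ k)%:E.

Lemma hausdorff_weight_ge0 n k (U : set 'rV[R]_n) :
  (0 <= hausdorff_weight k U)%E.
Proof.
rewrite lee_fin mulr_ge0//.
  rewrite /ball_volume divr_ge0 ?powR_ge0//; apply: Rintegral_ge0 => t _.
  by rewrite mulr_ge0 ?powR_ge0 ?expR_ge0.
rewrite exprn_ge0// divr_ge0//.
have [->|/set0P[x Ux]] := eqVneq U set0.
  suff -> : diam (set0 : set 'rV[R]_n) = -oo%E by [].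
  rewrite /diam (_ : [set _ | _ in _ & _ in _] = set0) ?ereal_sup0//.
  by apply/seteqP; split=> // _ [x []].
apply: fine_ge0; apply: le_trans (_ : (enorm (x - x))%:E <= _)%E.
  by rewrite lee_fin sqrtr_ge0.
by apply: ereal_sup_ubound; exists x => //; exists x.
Qed.

Definition hausdorff_pre n k (delta : R) : set 'rV[R]_n -> \bar R :=
  cover_measure [set U : set 'rV[R]_n | (diam U <= delta%:E)%E]
    id (hausdorff_weight k).

Definition hausdorff n k (X : set 'rV[R]_n) : \bar R :=
  ereal_sup [set hausdorff_pre k delta X | delta in [set d : R | 0 < d]].

(* Lebesgue outer measure of R^n, by covers with the boxes
   [a_1, b_1[ x ... x [a_n, b_n[ *)
Definition box n (ab : 'rV[R]_n * 'rV[R]_n) : set 'rV[R]_n :=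
  [set x | forall i, ab.1 0 i <= x 0 i < ab.2 0 i].

Definition box_volume n (ab : 'rV[R]_n * 'rV[R]_n) : \bar R :=
  (\prod_i (ab.2 0 i - ab.1 0 i))%:E.

Definition lebesgue n : set 'rV[R]_n -> \bar R :=
  cover_measure [set ab : 'rV[R]_n * 'rV[R]_n | forall i, ab.1 0 i <= ab.2 0 i]
    (@box n) (@box_volume n).

End euclidean_space.

Section outer_measures.
Context (R : realType) (n k : nat).
Local Open Scope ereal_scope.

Let hpre_le (delta : R) (X : set 'rV[R]_n) : (0 < delta)%R ->
  hausdorff_pre k delta X <= hausdorff k X.
Proof. by move=> d0; apply: ereal_sup_ubound; exists delta. Qed.

Let hpre_ge0 (delta : R) (X : set 'rV[R]_n) : 0 <= hausdorff_pre k delta X.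
Proof. by apply: cover_measure_ge0 => U _; exact: hausdorff_weight_ge0. Qed.

Lemma hausdorff_ge0 (X : set 'rV[R]_n) : 0 <= hausdorff k X.
Proof. exact: le_trans (hpre_ge0 1 X) (hpre_le _ ltr01). Qed.

Lemma hausdorff0 : hausdorff k (set0 : set 'rV[R]_n) = 0.
Proof.
apply/eqP; rewrite eq_le hausdorff_ge0 andbT.
apply: ge_ereal_sup => _ [d d0 <-]; rewrite /hausdorff_pre cover_measure0//.
by move=> U _; exact: hausdorff_weight_ge0.
Qed.

Lemma le_hausdorff :
  {homo @hausdorff R n k : A B / A `<=` B >-> A <= B}.
Proof.
move=> A B AB; apply: ge_ereal_sup => _ [d d0 <-].
exact: le_trans (le_cover_measure _ _ _ AB) (hpre_le _ d0).
Qed.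

Lemma hausdorff_sigma_subadditive : sigma_subadditive (@hausdorff R n k).
Proof.
move=> F; apply: ge_ereal_sup => _ [d d0 <-].
apply: le_trans (cover_measure_sigma_subadditive _ _ _) _ => [U _|].
  exact: hausdorff_weight_ge0.
by apply: lee_nneseries => i _ *; [exact: hpre_ge0|exact: hpre_le].
Qed.

HB.instance Definition _ := isOuterMeasure.Build R 'rV[R]_n (@hausdorff R n k)
  hausdorff0 hausdorff_ge0 le_hausdorff hausdorff_sigma_subadditive.

Let volume_ge0 (ab : 'rV[R]_n * 'rV[R]_n) :
  (forall i, (ab.1 0 i <= ab.2 0 i)%R) -> 0 <= box_volume ab.
Proof.
by move=> h; rewrite lee_fin prodr_ge0// => i _; rewrite subr_ge0.
Qed.

Lemma lebesgue0 : lebesgue (set0 : set 'rV[R]_n) = 0.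
Proof. by apply: cover_measure0; exact: volume_ge0. Qed.

Lemma lebesgue_ge0 (X : set 'rV[R]_n) : 0 <= lebesgue X.
Proof. by apply: cover_measure_ge0; exact: volume_ge0. Qed.

Lemma lebesgue_sigma_subadditive : sigma_subadditive (@lebesgue R n).
Proof. by apply: cover_measure_sigma_subadditive; exact: volume_ge0. Qed.

HB.instance Definition _ := isOuterMeasure.Build R 'rV[R]_n (@lebesgue R n)
  lebesgue0 lebesgue_ge0 (@le_cover_measure _ _ _ _ _ _)
  lebesgue_sigma_subadditive.

End outer_measures.

(* Integral with respect to the measure that an outer measure induces on its
   Caratheodory measurable sets *)
Definition cara_integral (R : realType) (T : pointedType)
    (mu : {outer_measure set T -> \bar R}) (D : set T) (f : T -> R) : R :=
  \int[(mu : {measure set (caratheodory_type mu) -> \bar R})]_(x in D) f x.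

(* Integral of a vector-valued map, computed coordinatewise *)
Definition vintegral (R : realType) (T : pointedType) (V : vectType R)
    (mu : {outer_measure set T -> \bar R}) (D : set T) (f : T -> V) : V :=
  let e := vbasis {:V} in
  \sum_i cara_integral mu D (fun x => coord e i (f x)) *: e`_i.

Section operators.
Context (R : realType) (n : nat) (V W : innerProductType R).
Implicit Types (A : 'I_n -> 'Hom(V, W)) (u : 'rV[R]_n -> V).

Definition symbol A (xi : 'rV[R]_n) : 'Hom(V, W) := \sum_i xi 0 i *: A i.

Definition nonzero_freq A : set 'rV[R]_n :=
  [set zeta | (0 < \dim (limg (symbol A zeta)))%N].

Definition partial (i : 'I_n) u : 'rV[R]_n -> V := 'D_(delta_mx 0 i) u.

(* All iterated partial derivatives exist and are continuous. *)
Definition smooth u : Prop := forall s : seq 'I_n,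
  let v := foldr partial u s in
  continuous v /\ forall i x, derivable v x (delta_mx 0 i).

Definition diff_op A u (x : 'rV[R]_n) : W := \sum_i A i (partial i u x).

Definition sphere (s : R) : set 'rV[R]_n := [set x | enorm x = s].

Definition spherical_op A (s : R) u (x : 'rV[R]_n) : W :=
  (n%:R * (fine (hausdorff n.-1 (sphere s)))^-1) *:
  vintegral (@hausdorff R n n.-1) (sphere s) (fun omega =>
    symbol A (s^-1 *: omega) (s^-1 *: (u (x + omega) - u x))).

Definition unit_cube : set 'rV[R]_n := [set x | forall i, 0 <= x 0 i < 1].

Definition D_sharp : set ('rV[R]_n -> V) := [set u |
  [/\ smooth u,
      forall x i, u (x + delta_mx 0 i) = u x &
      vintegral (@lebesgue R n) unit_cube u = 0]].

Definition quasiconvex (Op : ('rV[R]_n -> V) -> 'rV[R]_n -> W) (h : V -> R) :=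
  forall (v : V) u, D_sharp u -> (forall x, Op u x = 0) ->
    h v <= cara_integral (@lebesgue R n) unit_cube (fun x => h (u x + v)).

End operators.

(* Main.v *)
From HB Require Import structures.
Require Import Defs.
From mathcomp Require Import all_boot all_order all_algebra.
From mathcomp Require Import all_classical all_reals all_analysis.
From mathcomp Require Import measurable_realfun lra ring zify.

(** For a smooth periodic map [u], the two equations [diff_op A u = 0] and
    [spherical_op A s u = 0] are equivalent; quasiconvexity then quantifies over
    the same maps [u] on both sides.

    By the divergence theorem, [spherical_op A s u] is the mean of [diff_op A u]
    over balls of radius [s]. This convolution multiplies the Fourier coefficient
    of frequency [m != 0] of [diff_op A u] by a nonzero multiple of
    [besselJ (n / 2) (2 pi s |m|)] divided by a power of [|m|]. So the first equation
    implies the second one. Conversely, the second one forces the coefficients of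
    [diff_op A u] to vanish at the frequencies where the Bessel function does not;
    at the other ones the symbol is zero, and so is the coefficient.

    The multiplier is computed on the sphere itself, without the divergence
    theorem or polar coordinates. It is the factor [c] of [sint_coord_sin]: the
    integral over the sphere of [y_i sin (y . xi)] is [xi_i * c]. The Hausdorff
    measure of the sphere is finite, positive and invariant under reflections
    ([hausdorff_sphere_fin], [hausdorff_sphere_gt0], [hausdorff_isometry]), and
    closed sets are measurable for it ([caratheodory_closed]), so that continuous
    functions can be integrated. Rotation invariance alone determines the moments of
    the sphere up to a factor through a recursion ([momentS]), and the sine series
    turns them into the Bessel series ([moment_Gamma], [sine_coeff_bessel]).

    On the torus, the integral of a continuous function is the limit [mean] of its
    Riemann sums. It is translation invariant, which gives integration by parts
    ([mean_parts]); it commutes with the integral over the sphere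
    ([mean_sphere_mean]); and a continuous periodic function without Fourier
    coefficients is zero ([fourier_null_eq0]), by concentration of the powers of a
    trigonometric polynomial. Together these give the equivalence for scalar
    components ([divergence_sphere_flux]), and the vector-valued case follows by
    taking coordinates ([diff_op_spherical_op]). *)

Set Implicit Arguments.
Unset Strict Implicit.
Unset Printing Implicit Defensive.

Import Order.TTheory GRing.Theory Num.Theory.
Import numFieldNormedType.Exports.

Local Open Scope classical_set_scope.
Local Open Scope ring_scope.

(** * The Gamma function *)

Section gamma_function.
Context {R : realType}.
Notation mu := (@lebesgue_measure R).
Implicit Types a t x : R.

Let g a t : R := t `^ a * expR (- t).
Let e2 t : R := expR (- (t / 2)).

(** One term of the exponential series dominates a given power. *)
Lemma powR_expR_bound a : 0 <= a ->
  exists2 K : R, 0 <= K & forall t, 0 <= t -> t `^ a * expR (- t) <= K * expR (- (t / 2)).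
Proof.
move=> a0; pose N := Num.trunc a; pose K : R := 1 + N.+1`!%:R * 2 ^+ N.+1.
have K0 : 0 <= K by rewrite addr_ge0// mulr_ge0// exprn_ge0.
exists K => // t t0; suff tK : t `^ a <= K * expR (t / 2).
  have -> : - t = - (t / 2) + - (t / 2) by lra.
  rewrite expRD mulrA ler_wpM2r ?expR_ge0//.
  by rewrite expRN ler_pdivrMr ?expR_gt0.
apply: (@le_trans _ _ (1 + t ^+ N.+1)).
  have [t1|/ltW t1] := leP t 1.
    apply: (@le_trans _ _ 1); last by rewrite lerDl exprn_ge0.
    have <- : 1 `^ a = 1 :> R by rewrite powR1.
    by apply: ge0_ler_powR; rewrite ?nnegrE.
  apply: (@le_trans _ _ (t `^ N.+1%:R)); last first.
    by rewrite powR_mulrn// lerDr.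
  by apply: ler_powR => //; exact/ltW/truncnS_gt.
have t2 : 0 <= t / 2 by lra.
have := expR_ge1Dxn N t2; set E := expR _ => Ege.
have E1 : 1 <= E.
  by apply: le_trans Ege; rewrite lerDl divr_ge0// exprn_ge0.
rewrite mulrDl mul1r lerD// -[t in leLHS](@divfK _ 2)// exprMn mulrC.
rewrite -mulrA mulrCA ler_wpM2l ?exprn_ge0// -ler_pdivrMl ?ltr0n ?fact_gt0//.
rewrite mulrC; apply: le_trans Ege; by rewrite lerDr.
Qed.

Let e2_oo : e2 t @[t --> +oo] --> (0 : R).
Proof.
have h : (t / 2 : R) @[t --> +oo] --> +oo.
  apply: gt0_cvgMly; [by rewrite invr_gt0|exact: cvg_id].
exact: (cvg_comp _ _ h (@cvgr_expR R)).
Qed.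

Let is_derive_e2 t : is_derive t 1 e2 (- 2^-1 * e2 t).
Proof.
apply: (@is_derive_eq _ _ _ _ _ _ _ _ _); rewrite /=.
rewrite !scaler0 add0r /e2 /GRing.scale/=; ring.
Qed.

Let measurable_g a (D : set R) : measurable_fun D (EFin \o g a).
Proof.
apply/measurable_EFinP; apply: measurable_funTS; apply: measurable_funM.
  exact: measurable_powR.
by apply: measurableT_comp => //; exact: measurable_expR.
Qed.

Let integral_e2 : (\int[mu]_(t in `[0%R, +oo[) (e2 t)%:E)%E = 2%:E.
Proof.
rewrite (@ge0_continuous_FTC2y R e2 (fun t => - 2 * e2 t) 0 0).
- by rewrite -EFinB sub0r mulNr opprK /e2 mul0r oppr0 expR0 mulr1.
- by move=> x _; exact: expR_ge0.
- apply: continuous_subspaceT => x.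
  by apply: differentiable_continuous; apply/derivable1_diffP; exact: ex_derive.
- rewrite -[X in _ --> X](mulr0 (-2)); apply: cvgM; [exact: cvg_cst|exact: e2_oo].
- by move=> x _; exact: ex_derive.
- apply: cvg_at_right_filter; apply: cvgM; first exact: cvg_cst.
  by apply: differentiable_continuous; apply/derivable1_diffP; exact: ex_derive.
- move=> x _; rewrite derive1E derive_val /=.
  by rewrite scaler0 /e2 /GRing.scale/=; field.
Qed.

Let integrable_e2 : mu.-integrable `[0, +oo[ (EFin \o e2).
Proof.
apply/integrableP; split.
  apply/measurable_EFinP; apply: measurable_funTS.
  apply: measurableT_comp; first exact: measurable_expR.
  by apply: measurableT_comp => //; exact: mulrr_measurable.
under eq_integral do rewrite /= ger0_norm ?expR_ge0//.
by rewrite integral_e2 ltry.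
Qed.

Lemma Gamma_integrable a : 0 <= a -> mu.-integrable `[0, +oo[ (EFin \o g a).
Proof.
move=> a0; have [K K0 gK] := powR_expR_bound a0.
have : mu.-integrable `[0, +oo[ (fun t => K%:E * (e2 t)%:E)%E.
  by apply: integrableZl => //; exact: integrable_e2.
apply: le_integrable => //; first exact: measurable_g.
move=> t /=; rewrite in_itv/= andbT => t0.
rewrite lee_fin ger0_norm ?mulr_ge0 ?powR_ge0 ?expR_ge0//.
by rewrite ger0_norm ?mulr_ge0 ?expR_ge0 ?gK.
Qed.

Lemma GammaE x : 1 <= x -> Gamma x = \int[mu]_(t in `[0, +oo[) g (x - 1) t.
Proof.
move=> x1; rewrite /Gamma Rintegral_itv_obnd_cbnd//.
apply: integrableS (Gamma_integrable _) => //; last by rewrite subr_ge0.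
by apply: subset_itvr; rewrite bnd_simp.
Qed.

Lemma Gamma_gt0 x : 1 <= x -> 0 < Gamma x.
Proof.
move=> x1; have x0 : 0 <= x - 1 by rewrite subr_ge0.
rewrite GammaE// /Rintegral fine_gt0//; apply/andP; split; last first.
  have /integrableP[_] := Gamma_integrable x0.
  apply: le_lt_trans; apply: ge0_le_integral => //.
  - by move=> t _; rewrite lee_fin mulr_ge0 ?powR_ge0 ?expR_ge0.
  - exact: measurable_g.
  - by apply: measurableT_comp => //; exact: measurable_g.
  - by move=> t _; exact: lee_abs.
apply: (@lt_le_trans _ _ (\int[mu]_(t in `[1%R, 2%R]) (cst (expR (- 2))%:E t))%E).
  rewrite integral_cst//= lebesgue_measure_itv/= lte_fin ltr1n -EFinB -EFinM.
  rewrite lte_fin mulr_gt0 ?expR_gt0//; lra.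
apply: (@le_trans _ _ (\int[mu]_(t in `[1%R, 2%R]) (g (x - 1) t)%:E)%E).
  apply: ge0_le_integral => //.
  - by move=> t _; rewrite lee_fin expR_ge0.
  - exact: measurable_g.
  - move=> t /=; rewrite in_itv/= => /andP[t1 t2]; rewrite lee_fin /g.
    rewrite -[leLHS]mul1r; apply: ler_pM; rewrite ?expR_ge0//.
      by have := ler_powR t1 x0; rewrite powRr0.
    by rewrite ler_expR lerN2.
apply: ge0_subset_integral => //.
- exact: measurable_g.
- by move=> t _; rewrite lee_fin mulr_ge0 ?powR_ge0 ?expR_ge0.
- by move=> t /=; rewrite !in_itv/= andbT => /andP[t1 _]; lra.
Qed.

(** The derivative [t^x e^-t - x t^(x-1) e^-t] of [- t^x e^-t] changes sign, so
    that a multiple of [e^(-t/2)] is added before the fundamental theorem of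
    calculus on a half-line is applied to it. *)
Lemma GammaS x : 1 < x -> Gamma (x + 1) = x * Gamma x.
Proof.
move=> x1; have x0 : 0 <= x by lra.
have x10 : 0 <= x - 1 by lra.
rewrite !GammaE; [|lra..]; rewrite addrK.
have [K K0 gK] := powR_expR_bound x10; have [L L0 gL] := powR_expR_bound x0.
have ig := Gamma_integrable x0; have ig1 := Gamma_integrable x10.
(* [f] is the derivative of [F], and the choice of [K] makes it nonnegative. *)
pose f t := g x t - x * g (x - 1) t + x * K * e2 t.
pose F t := - g x t - 2 * (x * K) * e2 t.
have cg (b : R) : 0 < b -> {within `[0, +oo[, continuous (g b)}.
  move=> b0; apply/continuous_within_itvcyP; split.
    move=> t; rewrite in_itv/= andbT => t0; apply: cvgM.
      have [/derivable1_diffP/differentiable_continuous cp _] := is_derive1_powR b t0.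
      exact: cp.
    by apply: continuous_comp; [exact: opp_continuous|exact: continuous_expR].
  apply: cvgM; last first.
    apply: cvg_at_right_filter.
    by apply: continuous_comp; [exact: opp_continuous|exact: continuous_expR].
  by rewrite powR0 ?gt_eqF//; exact: powR_cvg0.
have ce2 : continuous e2.
  move=> t; apply: differentiable_continuous; apply/derivable1_diffP; exact: ex_derive.
have dF t : 0 < t -> is_derive t 1 F (f t).
  move=> t0; have dp := @is_derive1_powR _ x _ t0.
  apply: is_derive_eq; rewrite /f /g /=.
  rewrite /GRing.scale/= /GRing.scale/=.
  by rewrite /e2; field.
have : \int[mu]_(t in `[0, +oo[) f t = 0 - F 0.
  apply: Rintegral_ge0_continuous_FTC2y.
  - move=> t t0; rewrite /f -addrA addr_ge0 ?mulr_ge0 ?powR_ge0 ?expR_ge0//.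
    rewrite -mulrA addrC -mulrBr mulr_ge0// subr_ge0; exact: gK.
  - have cf1 := cg x (lt_trans ltr01 x1).
    have cf2 : {within `[0, +oo[, continuous (g (x - 1))} by apply: cg; rewrite subr_gt0.
    have ce : {within `[0, +oo[, continuous e2} by exact: continuous_subspaceT.
    move=> t; apply: cvgD; [apply: cvgB|]; first exact: cf1.
      by apply: cvgM; [exact: cvg_cst|exact: cf2].
    by apply: cvgM; [exact: cvg_cst|exact: ce].
  - rewrite -[X in _ --> X](subr0 0); apply: cvgB; last first.
      rewrite -[X in _ --> X](mulr0 (2 * (x * K))).
      by apply: cvgM; [exact: cvg_cst|exact: e2_oo].
    rewrite -[X in _ --> X]oppr0; apply: cvgN.
    apply: (@squeeze_cvgr _ _ _ _ (fun=> 0) (fun t => L * e2 t)).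
    + near=> t; rewrite mulr_ge0 ?powR_ge0 ?expR_ge0//=; apply: gL.
      by near: t; exact: nbhs_pinfty_ge.
    + exact: cvg_cst.
    + rewrite -[X in _ --> X](mulr0 L).
      by apply: cvgM; [exact: cvg_cst|exact: e2_oo].
  - by move=> t t0; have := dF t t0 => ?; exact: ex_derive.
  - apply: cvgB.
      apply: cvgN.
      by have /continuous_within_itvcyP[_] := cg x (lt_trans ltr01 x1).
    by apply: cvgM; [exact: cvg_cst|exact/cvg_at_right_filter/ce2].
  - move=> t; rewrite in_itv/= andbT => t0.
    by have := dF t t0 => ?; rewrite derive1E derive_val.
have Ie2 : \int[mu]_(t in `[0, +oo[) e2 t = 2.
  by rewrite /Rintegral integral_e2.
rewrite /f RintegralD//; last 2 first.
  apply: (@integrableB _ _ _ mu _ _ (EFin \o g x) (EFin \o (fun t => x * g (x - 1) t))) => //.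
  exact: (@integrableZl _ _ _ mu _ _ x _ ig1).
  exact: (@integrableZl _ _ _ mu _ _ (x * K) _ integrable_e2).
rewrite RintegralB//; last exact: (@integrableZl _ _ _ mu _ _ x _ ig1).
rewrite !RintegralZl// Ie2 /F /g /e2 powR0 ?gt_eqF ?(lt_trans ltr01 x1)//.
rewrite !mul0r oppr0 expR0 => ?; lra.
Unshelve. all: by end_near.
Qed.
End gamma_function.

(** * Closed sets are measurable for Hausdorff measures *)

Lemma continuous_sum (K : numFieldType) (T : topologicalType) (I : Type) (r : seq I)
    (P : pred I) (F : I -> T -> K) : (forall i, P i -> continuous (F i)) ->
  continuous (fun x => \sum_(i <- r | P i) F i x).
Proof.
move=> cF; elim: r => [|i r IH].
  rewrite (_ : (fun _ => _) = fun=> 0); last by apply/funext => x; rewrite big_nil.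
  by move=> x; exact: cvg_cst.
have [Pi|Pi] := boolP (P i); last first.
  rewrite (_ : (fun _ => _) = fun x => \sum_(j <- r | P j) F j x)//.
  by apply/funext => x; rewrite big_cons (negbTE Pi).
rewrite (_ : (fun _ => _) = fun x => F i x + \sum_(j <- r | P j) F j x).
  by move=> x; apply: cvgD; [exact: cF|exact: IH].
by apply/funext => x; rewrite big_cons Pi.
Qed.

Section enorm.
Context {R : realType} {n : nat}.
Implicit Types x y : 'rV[R]_n.

Lemma enorm_ge0 x : 0 <= enorm x.
Proof. exact: sqrtr_ge0. Qed.

Lemma sqr_enorm x : enorm x ^+ 2 = \sum_i x 0 i ^+ 2.
Proof. by rewrite sqr_sqrtr// sumr_ge0// => i _; exact: sqr_ge0. Qed.

Lemma enormN x : enorm (- x) = enorm x.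
Proof. by rewrite /enorm; under eq_bigr do rewrite mxE sqrrN. Qed.

Lemma ler_coord_enorm x i : `|x 0 i| <= enorm x.
Proof.
rewrite -sqrtr_sqr ler_sqrt ?sumr_ge0// => [|j _]; last exact: sqr_ge0.
by rewrite (bigD1 i)//= lerDl sumr_ge0// => j _; exact: sqr_ge0.
Qed.

Lemma ler_norm_enorm x : `|x| <= enorm x.
Proof.
rewrite [leLHS]mx_normrE; apply/bigmax_leP; split=> [|[i j] _ /=].
  exact: enorm_ge0.
by rewrite ord1; exact: ler_coord_enorm.
Qed.

End enorm.

Section metric_outer_measure.
Context {R : realType} (n k : nat).
Implicit Types X Y : set 'rV[R]_n.
Local Open Scope ereal_scope.

Lemma ge_hausdorff_pre (d d' : R) X : (d <= d')%R ->
  hausdorff_pre k d' X <= hausdorff_pre k d X.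
Proof.
move=> dd'; apply: ereal_inf_le_tmp => _ [F [CF XF] <-]; exists F => //.
split=> // j U /CF /= UD; apply: le_trans UD _.
by rewrite lee_fin.
Qed.

(** A set of diameter at most [e] meets at most one of [X] and [Y], so that a
    cover of the union splits into a cover of [X] and a cover of [Y]. *)
Lemma hausdorff_pre_separated (e : R) X Y :
  (forall x y, X x -> Y y -> (e < enorm (x - y))%R) ->
  hausdorff_pre k e X + hausdorff_pre k e Y <= hausdorff_pre k e (X `|` Y).
Proof.
move=> sepXY; apply: le_ereal_inf_tmp => _ [F [CF XYF] <-].
pose G (Z : set 'rV[R]_n) j :=
  if F j is Some U then if `[< U `&` Z !=set0 >] then Some U else None else None.
have GP Z : Z `<=` X `|` Y -> cover_of
    [set U : set 'rV[R]_n | diam U <= e%:E] id Z (G Z).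
  move=> ZXY; split=> [j U|z Zz].
    rewrite /G; case E : (F j) => [U'|//]; case: ifP => // _ [<-].
    exact: CF E.
  have [j _ Fj] := XYF _ (ZXY _ Zz); exists j => //.
  rewrite /G; case: (F j) Fj => [U|]//= Uz.
  by rewrite (_ : `[< _ >] = true) //; apply/asboolP; exists z.
have w0 Z j : 0 <= oapp (@hausdorff_weight R n k) 0 (G Z j).
  by case: (G Z j) => //= U; exact: hausdorff_weight_ge0.
apply: (@le_trans _ _ (\sum_(j <oo) oapp (@hausdorff_weight R n k) 0 (G X j) +
                      \sum_(j <oo) oapp (@hausdorff_weight R n k) 0 (G Y j))).
  by apply: leeD; apply: ereal_inf_lbound; [exists (G X)|exists (G Y)] => //;
    apply: GP => z; [left|right].
rewrite -nneseriesD//; apply: lee_nneseries => j _.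
  by rewrite adde_ge0.
rewrite /G; case E : (F j) => [U|/=]; last by rewrite adde0.
case: asboolP => [[x [Ux Xx]]|_]; case: asboolP => [[y [Uy Yy]]|_] /=;
  rewrite ?adde0 ?add0e ?hausdorff_weight_ge0//.
exfalso; have := sepXY _ _ Xx Yy; apply/negP; rewrite -leNgt.
rewrite -lee_fin; apply: le_trans (CF _ _ E).
by apply: ereal_sup_ubound; exists x => //; exists y.
Qed.

Lemma hausdorff_separated (e : R) X Y : (0 < e)%R ->
  (forall x y, X x -> Y y -> (e <= enorm (x - y))%R) ->
  hausdorff k X + hausdorff k Y <= hausdorff k (X `|` Y).
Proof.
move=> e0 sepXY.
have pre_ge0 (d : R) Z : 0 <= hausdorff_pre k d Z.
  by apply: cover_measure_ge0 => U _; exact: hausdorff_weight_ge0.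
have [->|] := eqVneq (hausdorff k (X `|` Y)) +oo; first by rewrite leey.
rewrite -ltey => XYoo.
have hfin Z : Z `<=` X `|` Y -> hausdorff k Z \is a fin_num.
  move=> ZXY; rewrite ge0_fin_numE ?hausdorff_ge0//.
  by apply: le_lt_trans XYoo; exact: (le_outer_measure (@hausdorff R n k)).
have Xf : hausdorff k X \is a fin_num by apply: hfin => z; left.
have XYf : hausdorff k (X `|` Y) \is a fin_num by exact: hfin.
have main (d d' : R) : (0 < d)%R -> (0 < d')%R ->
    hausdorff_pre k d X + hausdorff_pre k d' Y <= hausdorff k (X `|` Y).
  move=> d0 d'0; pose c := Num.min (Num.min d d') (e / 2)%R.
  have c0 : (0 < c)%R by rewrite !lt_min d0 d'0 divr_gt0.
  have [cd cd'] : (c <= d /\ c <= d')%R.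
    by split; rewrite /c !ge_min lexx ?orbT.
  apply: le_trans (leeD (ge_hausdorff_pre X cd) (ge_hausdorff_pre Y cd')) _.
  apply: le_trans (@hausdorff_pre_separated c X Y _) _.
    move=> x y Xx Yy; apply: lt_le_trans (sepXY _ _ Xx Yy).
    by rewrite /c gt_min ltr_pdivrMr// ltr_pMr// ltr1n orbT.
  by apply: ereal_sup_ubound; exists c.
have pref (d : R) Z : (0 < d)%R -> Z `<=` X `|` Y -> hausdorff_pre k d Z \is a fin_num.
  move=> d0 ZXY; rewrite ge0_fin_numE//; apply: le_lt_trans XYoo.
  apply: le_trans (le_outer_measure (@hausdorff R n k) _ _ ZXY).
  by apply: ereal_sup_ubound; exists d.
rewrite addeC -leeBrDr//; apply: ge_ereal_sup => _ [d' d'0 <-].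
rewrite leeBrDr// addeC -leeBrDr; last by apply: pref => // z; right.
apply: ge_ereal_sup => _ [d d0 <-].
by rewrite leeBrDr; [exact: main|apply: pref => // z; right].
Qed.

(** The classical argument for metric outer measures: [mu] is additive on
    sets at positive distance, and the shells [L j] between the superlevel
    sets of [f] that are two steps apart are at positive distance, so that their
    measures are summable; hence the superlevel sets exhaust [X `\` C] in
    measure. *)
Lemma caratheodory_sublevel (f : 'rV[R]_n -> R) :
  (forall x y, (`|f x - f y| <= enorm (x - y))%R) ->
  (@hausdorff R n k).-caratheodory [set x | (f x <= 0)%R].
Proof.
move=> lipf; set C := [set x | _]; pose mu : {outer_measure set 'rV[R]_n -> \bar R} := @hausdorff R n k.
apply: (@le_caratheodory_measurable R _ mu) => X.
have [->|] := eqVneq (mu X) +oo; first by rewrite leey.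
rewrite -ltey => Xoo.
pose a (j : nat) : R := (j.+1%:R^-1)%R.
have a_gt0 j : (0 < a j)%R by rewrite invr_gt0.
have a_lt j j' : (j < j')%N -> (a j' < a j)%R.
  by move=> jj'; rewrite ltf_pV2 ?posrE// ltr_nat.
pose S j := X `&` [set x | (a j <= f x)%R].
pose L j := X `&` [set x | (a j.+1 <= f x < a j)%R].
have sep (A B : set 'rV[R]_n) (c d : R) : (c < d)%R -> A `|` B `<=` X ->
    (forall x, A x -> (f x <= c)%R) -> (forall x, B x -> (d <= f x)%R) ->
    mu A + mu B <= mu (A `|` B).
  move=> cd ABX Ac Bd; apply: (@hausdorff_separated (d - c)%R).
    by rewrite subr_gt0.
  move=> x y /Ac fx /Bd fy; apply: le_trans (lipf x y).
  by rewrite distrC; apply: le_trans (ler_norm _); rewrite lerB.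
have mule (Y Z : set 'rV[R]_n) : Y `<=` Z -> mu Y <= mu Z.
  exact: le_outer_measure.
have SX j : S j `<=` X by move=> x [].
(* The shell [L m.+1] is at positive distance from [S m], and both lie in
   [S m.+2]; the index 0 is left out so that the induction can start. *)
have sumL m : \sum_(j < m) mu (L j.+1) <= mu (S m) + mu (S m.+1).
  elim: m => [|m ih]; first by rewrite big_ord0 adde_ge0// hausdorff_ge0.
  rewrite big_ord_recr/=; apply: le_trans (leeD2r _ ih) _.
  rewrite addeC addeA addeC; apply: leeD2l.
  apply: le_trans (sep _ _ (a m.+1) (a m) _ _ _ _) _; last first.
  - apply: mule => x [[Xx /= /andP[? _]]|[Xx /= amf]]; split=> //=.
    by apply: le_trans amf; apply/ltW/a_lt.
  - by move=> x [].
  - by move=> x [_ /= /andP[_ /ltW]].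
  - by move=> x [[]|[]].
  - exact: a_lt.
have cvgL : \sum_(0 <= j <oo) mu (L j.+1) < +oo.
  apply: (@le_lt_trans _ _ (mu X + mu X)); last by rewrite lte_add_pinfty.
  apply: lime_le.
    by apply: is_cvg_nneseries => j _ _; exact: hausdorff_ge0.
  near=> m; rewrite big_mkord; apply: le_trans (sumL m) _.
  by apply: leeD; exact: mule.
have tail0 := @nneseries_tail_cvg R (fun j => mu (L j.+1)) xpredT cvgL
  (fun j _ => outer_measure_ge0 mu _).
have bound j : mu (X `&` C) + mu (X `&` ~` C) <=
               mu X + \sum_(j <= i <oo) mu (L i.+1).
  have sub : X `&` ~` C `<=`
      S j.+1 `|` \bigcup_(i in ~` `I_j) L i.+1.
    move=> x [Xx /= /negP]; rewrite -ltNge => fx0.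
    have [afx|fxa] := leP (a j.+1) (f x); first by left.
    right; have exi : exists i, (a i <= f x)%R.
      exists (Num.trunc (f x)^-1)%R.
      rewrite -[leRHS]invrK lef_pV2 ?posrE ?invr_gt0//.
      by rewrite ltW// truncnS_gt.
    have [[|[|i]] ai imin] := ex_minnP exi.
    + by have := le_lt_trans ai fxa; rewrite ltNge (ltW (a_lt _ _ _)).
    + have := le_lt_trans ai fxa; rewrite ltNge; case: j {fxa} => [|j].
        by rewrite lexx.
      by rewrite (ltW (a_lt _ _ _)).
    + have ij : (j <= i)%N.
        rewrite leqNgt; apply/negP => ij.
        have := le_lt_trans ai fxa; rewrite ltNge => /negP; apply.
        by have [<-|ne] := eqVneq i.+2 j.+1; rewrite ?lexx// ltW// a_lt// ltn_neqAle ne.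
      exists i; first by apply/negP; rewrite -leqNgt.
      split=> //=; rewrite ai /= ltNge; apply/negP => /imin.
      by rewrite ltnn.
  apply: (@le_trans _ _ (mu (X `&` C) + (mu (S j.+1) +
      \sum_(j <= i <oo) mu (L i.+1)))).
    apply: leeD2l; apply: le_trans (mule _ _ sub) _.
    apply: le_trans (outer_measureU2 mu _ _) _; apply: leeD2l.
    exact: (outer_measure_sigma_subadditive_tail mu j (fun i => L i.+1)).
  rewrite addeA; apply: leeD2r.
  apply: le_trans (sep _ _ 0%R (a j.+1) _ _ _ _) _ => //.
  - by move=> x [[]|[]].
  - by move=> x [].
  - by move=> x [].
  - by apply: mule => x [[]|[]].
have Xf : mu X \is a fin_num by rewrite ge0_fin_numE ?hausdorff_ge0.
have lim0 : (fun j => mu X + \sum_(j <= i <oo) mu (L i.+1)) @ \oo --> mu X + 0.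
  by apply: cvgeD; [rewrite fin_num_adde_defr|exact: cvg_cst|].
rewrite -[leRHS]adde0 -(cvg_lim _ lim0)//.
apply: lime_ge; first by apply/cvg_ex; exists (mu X + 0).
by apply: nearW.
Unshelve. all: by end_near.
Qed.

(** [C] is the zero set of the distance to [C], which is 1-Lipschitz. *)
Lemma caratheodory_closed (C : set 'rV[R]_n) :
  closed C -> (@hausdorff R n k).-caratheodory C.
Proof.
move=> cC; have [->|/set0P[c0 Cc0]] := eqVneq C set0.
  exact: caratheodory_measurable_set0.
pose d (x : 'rV[R]_n) : R := inf [set `|x - c|%R | c in C].
have dhas (x : 'rV[R]_n) : has_inf [set `|x - c|%R | c in C].
  by split; [exists `|x - c0|%R, c0|exists 0%R => _ [c _ <-]].
have d_le (x y : 'rV[R]_n) : (d x - d y <= `|x - y|)%R.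
  rewrite lerBlDr addrC -lerBlDr; apply: lb_le_inf; first exact: (dhas y).1.
  move=> _ [c Cc <-]; rewrite lerBlDr; apply: (@le_trans _ _ `|x - c|%R).
    by apply: ge_inf; [exact: (dhas x).2|exists c].
  by rewrite [leRHS]addrC ler_distD.
suff -> : C = [set x | (d x <= 0)%R].
  apply: caratheodory_sublevel => x y; apply: le_trans (ler_norm_enorm _).
  by rewrite ler_norml d_le andbT lerNl opprB distrC d_le.
apply/seteqP; split=> x /= Cx.
  by apply: ge_inf; [exact: (dhas x).2|exists x => //; rewrite subrr normr0].
apply: cC => B /nbhs_ballP[e /= e0 eB].
have [_ [c Cc <-] xce] := inf_adherent e0 (dhas x).
exists c; split=> //; apply: eB; rewrite mx_norm_ball /ball_/=.
by apply: lt_le_trans xce _; rewrite gerDr.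
Qed.

End metric_outer_measure.

(** * Invariance of Hausdorff measures and finite measure of spheres *)

Section isometry.
Context {R : realType} (n k : nat).
Variable rho : 'rV[R]_n -> 'rV[R]_n.
Hypothesis rho_inv : involutive rho.
Hypothesis rho_iso : forall x y, enorm (rho x - rho y) = enorm (x - y).

Lemma diam_isometry (U : set 'rV[R]_n) : diam (rho @^-1` U) = diam U.
Proof.
rewrite /diam; congr ereal_sup; apply/seteqP; split=> _ [x Ux [y Uy <-]].
  by exists (rho x) => //; exists (rho y) => //; rewrite rho_iso.
by exists (rho x); rewrite /= ?rho_inv//; exists (rho y);
  rewrite /= ?rho_inv// rho_iso.
Qed.

(** Covers pull back along [rho] with the same weights; as [rho] is an
    involution, one inequality yields the other. *)
Lemma hausdorff_isometry (X : set 'rV[R]_n) :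
  hausdorff k (rho @^-1` X) = hausdorff k X.
Proof.
suff le Y : (hausdorff k (rho @^-1` Y) <= hausdorff k Y)%E.
  apply/eqP; rewrite eq_le le /=.
  have {1}-> : X = rho @^-1` (rho @^-1` X).
    by apply/seteqP; split=> x; rewrite /= rho_inv.
  exact: le.
apply: ge_ereal_sup => _ [e e0 <-].
apply: (@le_trans _ _ (hausdorff_pre k e Y)); last first.
  by apply: ereal_sup_ubound; exists e.
apply: le_ereal_inf_tmp => _ [F [CF YF] <-]; apply: ereal_inf_lbound.
exists (fun j => omap (preimage rho) (F j)).
  split=> [j U|x /YF[j _ Fj]].
    by case E : (F j) => [U'|]//= [<-]; rewrite diam_isometry; exact: CF E.
  by exists j => //; case: (F j) Fj.
apply: congr_lim; apply/funext => m; apply: eq_bigr => j _.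
by case: (F j) => //= U; rewrite /hausdorff_weight diam_isometry.
Qed.

End isometry.

Section sphere_finite.
Context {R : realType} (d : nat).
Implicit Types x y : 'rV[R]_d.+1.

Lemma ball_volume_gt0 (k : nat) : 0 < ball_volume k :> R.
Proof.
rewrite divr_gt0// ?powR_gt0 ?pi_gt0//.
by apply: Gamma_gt0; rewrite lerDr divr_ge0.
Qed.

Lemma fine_diam_ge0 n (U : set 'rV[R]_n) : 0 <= fine (diam U).
Proof.
have [->|/set0P[x Ux]] := eqVneq U set0.
  suff -> : diam (set0 : set 'rV[R]_n) = -oo%E by [].
  rewrite /diam (_ : [set _ | _ in _ & _ in _] = set0) ?ereal_sup0//.
  by apply/seteqP; split=> // _ [x []].
apply: fine_ge0; apply: le_trans (_ : (enorm (x - x))%:E <= _)%E.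
  by rewrite lee_fin sqrtr_ge0.
by apply: ereal_sup_ubound; exists x => //; exists x.
Qed.

Lemma fine_diam_le n (U : set 'rV[R]_n) (e : R) : 0 <= e ->
  (diam U <= e%:E)%E -> fine (diam U) <= e.
Proof. by move=> e0; case: (diam U) => //= r; rewrite lee_fin. Qed.

Lemma hausdorff_pre_le_sum n k (e w : R) (X : set 'rV[R]_n) (T : finType)
    (U : T -> set 'rV[R]_n) :
  (forall i, (diam (U i) <= e%:E)%E) ->
  (forall i, (hausdorff_weight k (U i) <= w%:E)%E) ->
  X `<=` \bigcup_i U i ->
  (hausdorff_pre k e X <= (#|T|%:R * w)%:E)%E.
Proof.
move=> dU wU XU; pose F (j : nat) : option (set 'rV[R]_n) :=
  omap (fun i : 'I_#|T| => U (enum_val i)) (insub j).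
apply: (@le_trans _ _ (\sum_(j <oo) oapp (@hausdorff_weight R n k) 0 (F j))%E).
  apply: ereal_inf_lbound; exists F => //; split=> [j V|x /XU[i _ Ux]].
    by rewrite /F; case: insubP => // i _ _ [<-]; exact: dU.
  exists (enum_rank i) => //; rewrite /F insubT//= => lti.
  by rewrite (_ : Sub _ _ = enum_rank i) ?enum_rankK//; exact: val_inj.
rewrite (nneseries_split _ #|T|); last first.
  by move=> j _; case: (F j) => //= V; exact: hausdorff_weight_ge0.
rewrite add0n [X in (_ + X)%E]eseries0 ?adde0; last first.
  by move=> j jT _; rewrite /F insubF//= ltnNge jT.
rewrite big_mkord mulr_natl -[#|T| in leRHS]card_ord -sumr_const -sumEFin.
by apply: lee_sum => i _; rewrite /F insubT//=; exact: wU.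
Qed.

Lemma enorm_le_sum n (x : 'rV[R]_n) : enorm x <= \sum_i `|x 0 i|.
Proof.
have s0 : 0 <= \sum_i `|x 0 i| by rewrite sumr_ge0.
rewrite -(ger0_norm s0) -sqrtr_sqr ler_sqrt ?sqr_ge0//.
rewrite expr2 mulr_suml; apply: ler_sum => i _.
rewrite -[x 0 i ^+ 2]real_normK ?num_real// expr2 ler_wpM2l//.
by rewrite (bigD1 i)//= lerDl sumr_ge0.
Qed.

Lemma sphere_coord (s : R) x i : sphere s x -> `|x 0 i| <= s.
Proof. by move=> <-; exact: ler_coord_enorm. Qed.

Lemma sphere_sqr (s : R) x : sphere s x -> \sum_i x 0 i ^+ 2 = s ^+ 2.
Proof. by move=> <-; rewrite sqr_enorm. Qed.

Lemma sphere_big_coord (s : R) x : 0 < s -> sphere s x ->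
  exists i, s / d.+1%:R <= `|x 0 i|.
Proof.
move=> s0 Sx; apply: contrapT => /forallNP h.
have : \sum_i x 0 i ^+ 2 < s ^+ 2.
  apply: (@lt_le_trans _ _ (\sum_(i < d.+1) (s / d.+1%:R) ^+ 2)).
    apply: ltr_sum; first by apply/hasP; exists ord0 => //; rewrite mem_index_enum.
    move=> i _; rewrite -[x 0 i ^+ 2]real_normK ?num_real//.
    by rewrite ltrXn2r// ltNge; apply/negP/h.
  rewrite sumr_const card_ord -[leLHS]mulr_natr expr_div_n -mulrA ler_piMr ?sqr_ge0//.
  by rewrite ler_pdivrMl ?exprn_gt0// mulr1 ler_eXnr// ler1n.
by rewrite (sphere_sqr Sx) ltxx.
Qed.

(** Near a point where [`|x 0 i| >= s / n], the sphere is a Lipschitz graph over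
    the hyperplane of the other coordinates: the cells of a grid of this
    hyperplane lift to sets of comparable diameter. *)
Lemma hausdorff_sphere_fin (s : R) : 0 < s ->
  (hausdorff d (sphere s : set 'rV[R]_d.+1) < +oo)%E.
Proof.
move=> s0; (* A cell has d coordinates within [s / N]; the last one varies by at most
   [2 * d * d.+1 * (s / N)], by the estimate [s2] below. *)
pose C : R := d%:R + 2 * d%:R * d.+1%:R.
have C0 : 0 <= C by rewrite addr_ge0// !mulr_ge0.
pose B : R := d.+1%:R * 2 * (3 ^+ d * (ball_volume d * (C * s / 2) ^+ d)).
apply: (@le_lt_trans _ _ B%:E); last exact: ltry.
apply: ge_ereal_sup => _ [e /= e0 <-].
pose N := (Num.trunc (C * s / e)).+1.
have N0 : 0 < N%:R :> R by rewrite ltr0n.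
have Ne : C * (s / N%:R) <= e.
  by rewrite mulrA ler_pdivrMr// -ler_pdivrMl// [leLHS]mulrC; exact/ltW/truncnS_gt.
pose T := ('I_d.+1 * bool * {ffun 'I_d -> 'I_(N.*2).+1})%type.
pose U (t : T) : set 'rV[R]_d.+1 := [set x | sphere s x /\
  s / d.+1%:R <= (-1) ^+ t.1.2 * x 0 t.1.1 /\
  forall j, (t.2 j)%:R * (s / N%:R) - s <= x 0 (lift t.1.1 j) <=
            (t.2 j).+1%:R * (s / N%:R) - s].
have dU t : (diam (U t) <= (C * (s / N%:R))%:E)%E.
  apply: ge_ereal_sup => _ [x [Sx [xi xj]] [y [Sy [yi yj]] <-]].
  rewrite lee_fin; apply: le_trans (enorm_le_sum _) _.
  have sN0 : 0 <= s / N%:R by rewrite divr_ge0// ltW.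
  have lej j : `|x 0 (lift t.1.1 j) - y 0 (lift t.1.1 j)| <= s / N%:R.
    have /andP[x1 x2] := xj j; have /andP[y1 y2] := yj j.
    move: x2 y2; rewrite -natr1 mulrDl mul1r => x2 y2.
    by rewrite ler_norml; apply/andP; split; lra.
  rewrite (bigD1_ord t.1.1)//= addrC mulrDl; apply: lerD.
    under eq_bigr do rewrite !mxE.
    apply: (@le_trans _ _ (\sum_(j < d) (s / N%:R))); first exact: ler_sum.
    by rewrite sumr_const card_ord mulr_natl.
  rewrite !mxE; set i := t.1.1 in xi yi lej *.
  set sg := (-1) ^+ t.1.2 in xi yi.
  have sgE : `|x 0 i - y 0 i| = `|sg * x 0 i - sg * y 0 i|.
    by rewrite -mulrBr normrM normr_sign mul1r.
  (* x_i ^ 2 - y_i ^ 2 is a sum of differences of squares of the other coordinates,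
     and x_i + y_i is bounded below. *)
  have s2 : `|sg * x 0 i - sg * y 0 i| * (s / d.+1%:R) <= d%:R * (s / N%:R) * (2 * s).
    have p0 : 0 < s / d.+1%:R by rewrite divr_gt0.
    apply: (@le_trans _ _ (`|sg * x 0 i - sg * y 0 i| * `|sg * x 0 i + sg * y 0 i|)).
      have y0 : 0 <= sg * y 0 i by apply: le_trans (ltW p0) yi.
      rewrite ler_wpM2l// ger0_norm.
        by rewrite -[leLHS]addr0 lerD.
      by rewrite addr_ge0//; exact: le_trans (ltW p0) xi.
    rewrite -normrM -subr_sqr !exprMn sqrr_sign !mul1r.
    have -> : x 0 i ^+ 2 - y 0 i ^+ 2 = \sum_j (y 0 (lift i j) ^+ 2 - x 0 (lift i j) ^+ 2).
      have := sphere_sqr Sx; have := sphere_sqr Sy.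
      rewrite !(bigD1_ord i)//= sumrB.
      set a := \sum_(_ < _) _; set b := \sum_(_ < _) _; lra.
    apply: le_trans (ler_norm_sum _ _ _) _.
    apply: (@le_trans _ _ (\sum_(j < d) (s / N%:R) * (2 * s))); last first.
      by rewrite sumr_const card_ord -[leRHS]mulrA [leRHS]mulr_natl.
    apply: ler_sum => j _; rewrite subr_sqr normrM ler_pM//.
      by rewrite distrC; exact: lej.
    apply: le_trans (ler_normD _ _) _.
    have := sphere_coord (lift i j) Sx; have := sphere_coord (lift i j) Sy; lra.
  rewrite sgE -(@ler_pM2r _ (s / d.+1%:R)) ?divr_gt0//.
  apply: le_trans s2 _; rewrite le_eqVlt; apply/orP; left; apply/eqP.
  have : d.+1%:R != 0 :> R by rewrite pnatr_eq0.
  have : N%:R != 0 :> R by rewrite pnatr_eq0.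
  move: (N%:R : R) (d.+1%:R : R) (d%:R : R) => a b c a0 b0.
  by field; rewrite a0 b0.
have wU t : (hausdorff_weight d (U t) <=
    (ball_volume d * (C * (s / N%:R) / 2) ^+ d)%:E)%E.
  rewrite lee_fin ler_wpM2l ?(ltW (ball_volume_gt0 _))//.
  apply: lerXn2r; rewrite ?nnegrE ?divr_ge0 ?fine_diam_ge0//.
    by rewrite mulr_ge0// divr_ge0// ltW.
  rewrite ler_wpM2r ?invr_ge0// fine_diam_le//.
  by rewrite mulr_ge0// divr_ge0// ltW.
apply: le_trans (hausdorff_pre_le_sum (e := e) _ wU _) _.
- by move=> t; apply: le_trans (dU t) _; rewrite lee_fin.
- move=> x Sx; have [i xi] := sphere_big_coord s0 Sx.
  pose c : {ffun 'I_d -> 'I_(N.*2).+1} :=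
    [ffun j => inord (Num.trunc ((x 0 (lift i j) + s) / (s / N%:R)))].
  exists (i, x 0 i < 0, c) => //; split=> //=; split=> [|j].
    by rewrite -normrEsign.
  rewrite ffunE; have := sphere_coord (lift i j) Sx; rewrite ler_norml => /andP[l1 l2].
  set z := x 0 (lift i j) in l1 l2 *.
  have sN0 : 0 < s / N%:R by rewrite divr_gt0.
  have z0 : 0 <= (z + s) / (s / N%:R) by rewrite divr_ge0 ?(ltW sN0)//; lra.
  have /andP[t1 t2] := trunc_itv z0.
  rewrite inordK; last first.
    rewrite ltnS -(ler_nat R); apply: le_trans t1 _.
    rewrite ler_pdivrMr//; suff -> : N.*2%:R * (s / N%:R) = 2 * s by lra.
    by rewrite -mul2n natrM; field; rewrite gt_eqF.
  move: t1 t2; rewrite ler_pdivlMr// ltr_pdivrMr// => t1 t2; apply/andP; split; lra.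
rewrite lee_fin /B !card_prod card_ord card_bool card_ffun !card_ord.
rewrite !natrM natrX.
have : 0 <= ball_volume d :> R by exact/ltW/ball_volume_gt0.
move: (ball_volume d) => b b0.
have key : N.*2.+1%:R * (C * (s / N%:R) / 2) <= 3 * (C * s / 2).
  apply: (@le_trans _ _ (3 * N%:R * (C * (s / N%:R) / 2))).
    rewrite ler_wpM2r ?divr_ge0 ?mulr_ge0 ?invr_ge0 ?(ltW s0)//.
    by rewrite -natrM ler_nat; lia.
  by rewrite le_eqVlt; apply/orP; left; apply/eqP; field; rewrite gt_eqF.
have -> (x y z : R) : d.+1%:R * 2 * x ^+ d * (z * y ^+ d) =
    d.+1%:R * 2 * z * (x * y) ^+ d by rewrite exprMn; ring.
have -> (x y z : R) : d.+1%:R * 2 * (x ^+ d * (z * y ^+ d)) =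
    d.+1%:R * 2 * z * (x * y) ^+ d by rewrite exprMn; ring.
rewrite ler_wpM2l ?mulr_ge0// lerXn2r ?nnegrE ?mulr_ge0 ?divr_ge0 ?(ltW s0)//.
Qed.

End sphere_finite.

(** * Positive measure of spheres *)

Section sphere_positive.
Context {R : realType}.
Notation leb := (@lebesgue_measure R).

(** Integrate the covering inequality over the last variable and exchange
    integral and series: one factor of each product becomes the length of an
    interval. *)
Lemma cube_cover_volume (a : R) (r : nat -> R) (p : nat -> nat -> R) (d : nat)
    (m : R) (c : nat -> R) : 0 <= a -> 0 <= m ->
  (forall k, 0 <= r k) -> (forall k, 0 <= c k) ->
  (forall x : nat -> R, (forall i, 0 <= x i <= a) ->
    (m%:E <= \sum_(k <oo)
      (c k * \prod_(i < d) \1_(`[(p k i - r k), (p k i + r k)]) (x i))%:E)%E) ->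
  ((m * a ^+ d)%:E <= \sum_(k <oo) (c k * (2 * r k) ^+ d)%:E)%E.
Proof.
move=> a0 + r0; elim: d m c => [|d IH] m c m0 c0 cov.
  rewrite expr0 mulr1; apply: le_trans (cov (fun=> 0) _) _.
    by move=> i; rewrite lexx.
  rewrite le_eqVlt; apply/orP; left; apply/eqP.
  by apply: eq_eseriesr => k _; rewrite big_ord0 expr0.
rewrite exprS mulrA; apply: le_trans (IH (m * a) (fun k => c k * (2 * r k)) _ _ _) _.
- by rewrite mulr_ge0.
- by move=> k; rewrite !mulr_ge0.
- move=> x xa.
  pose P k : R := \prod_(i < d) \1_(`[(p k i - r k), (p k i + r k)]) (x i).
  have P0 k : 0 <= P k by apply: prodr_ge0 => i _.
  pose I k : set R := `[(p k d - r k), (p k d + r k)]%classic.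
  have cov1 (t : R) : `[0, a]%classic t ->
      (m%:E <= \sum_(k <oo) (c k * P k * \1_(I k) t)%:E)%E.
    rewrite /= in_itv /= => ta.
    pose y i := if i == d then t else x i.
    have ya i : 0 <= y i <= a by rewrite /y; case: ifP.
    apply: le_trans (cov y ya) _; rewrite le_eqVlt; apply/orP; left; apply/eqP.
    apply: eq_eseriesr => k _; rewrite big_ord_recr/= mulrA /y eqxx.
    congr (_ * _ * _)%:E; apply: eq_bigr => i _.
    by rewrite ltn_eqF.
  have mI k : measurable_fun `[0, a] (fun t => (c k * P k * \1_(I k) t)%:E).
    apply/measurable_EFinP; apply: (@measurable_funM _ _ _ _ (cst _)).
      exact: measurable_cst.
    by apply: measurable_indic; exact: measurable_itv.
  apply: (@le_trans _ _ (\int[leb]_(t in `[0%R, a])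
      \sum_(k <oo) (c k * P k * \1_(I k) t)%:E)%E).
    apply: (@le_trans _ _ (\int[leb]_(t in `[0%R, a]) (cst m%:E t))%E).
      rewrite integral_cst//= lebesgue_measure_itv/= lte_fin.
      case: ltgtP a0 => // [a0 _|<- _]; first by rewrite -EFinB subr0.
      by rewrite mulr0 mule0.
    apply: ge0_le_integral => //.
    apply: (@ge0_emeasurable_sum _ _ _ _ (fun k t => (c k * P k * \1_(I k) t)%:E) xpredT).
      by move=> k t _ _; rewrite lee_fin !mulr_ge0.
    by move=> k _; exact: mI.
  rewrite integral_nneseries//; last first.
    by move=> k t _; rewrite lee_fin !mulr_ge0.
  apply: lee_nneseries => [k _ _|k _].
    by apply: integral_ge0 => t _; rewrite lee_fin !mulr_ge0.
  under eq_integral do rewrite EFinM.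
  rewrite ge0_integralZl_EFin//; last 2 first.
    by apply/measurable_EFinP; apply: measurable_indic; exact: measurable_itv.
    by rewrite mulr_ge0.
  rewrite mulrAC -/(P k) [leRHS]EFinM lee_wpmul2l ?lee_fin ?mulr_ge0//.
  rewrite integral_indic//; last exact: measurable_itv.
  apply: (@le_trans _ _ (leb (I k))).
    apply: le_measure; rewrite ?inE//.
      by apply: measurableI; exact: measurable_itv.
    exact: measurable_itv.
  rewrite /I lebesgue_measure_itv/= lte_fin; case: ifP => _.
    by rewrite -EFinB lee_fin; lra.
  by rewrite lee_fin mulr_ge0.
rewrite le_eqVlt; apply/orP; left; apply/eqP.
by apply: eq_eseriesr => k _; rewrite exprS !mulrA.
Qed.

(** The sphere projects onto a set that contains a cube of the equatorial
    hyperplane, and each member of a cover projects into a cube of side twice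
    its diameter. *)
Lemma hausdorff_sphere_gt0 d (s : R) : 0 < s ->
  (0 < hausdorff d (sphere s : set 'rV[R]_d.+1))%E.
Proof.
move=> s0; pose a := s / d.+1%:R; have a0 : 0 < a by rewrite divr_gt0.
pose b : R := ball_volume d / 4 ^+ d.
have b0 : 0 < b by rewrite divr_gt0 ?ball_volume_gt0// exprn_gt0.
apply: (@lt_le_trans _ _ (b * a ^+ d)%:E); first by rewrite lte_fin mulr_gt0// exprn_gt0.
apply: (@le_trans _ _ (hausdorff_pre d 1 (sphere s : set 'rV[R]_d.+1))); last first.
  by apply: ereal_sup_ubound; exists 1 => //=.
apply: le_ereal_inf_tmp => _ [F [CF SF] <-].
pose U k : set 'rV[R]_d.+1 := oapp id set0 (F k).
pose c k : R := (`[< U k !=set0 >])%:R.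
pose r k : R := fine (diam (U k)).
(* The coordinate 0 is the one recovered from the others, hence [i.+1]. *)
pose p k (i : nat) : R := (xget 0 (U k)) 0 (inord i.+1).
have r0 k : 0 <= r k by exact: fine_diam_ge0.
have c0 k : 0 <= c k by [].
apply: (@le_trans _ _ (b%:E * \sum_(k <oo) (c k * (2 * r k) ^+ d)%:E)%E); last first.
  rewrite -nneseriesZl; last by move=> k _; rewrite lee_fin mulr_ge0// exprn_ge0// mulr_ge0.
  apply: lee_nneseries => [k _ _|k _].
    by apply: mule_ge0; rewrite lee_fin ?(ltW b0)// mulr_ge0// exprn_ge0// mulr_ge0.
  rewrite /c /r /U; case: (F k) => [V|]/=; last first.
    rewrite (_ : `[< _ >] = false) ?mul0r ?mule0//.
    by apply/asboolP => -[].
  apply: (@le_trans _ _ (b%:E * ((2 * fine (diam V)) ^+ d)%:E)%E).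
    rewrite lee_wpmul2l ?lee_fin ?(ltW b0)// ler_piMl ?exprn_ge0 ?mulr_ge0 ?fine_diam_ge0//.
    by case: asboolP.
  rewrite lee_fin le_eqVlt /b -mulrA mulrC; apply/orP; left; apply/eqP.
  by rewrite mulrC; congr (_ * _); rewrite mulrC -expr_div_n; congr (_ ^+ _); field.
rewrite EFinM lee_wpmul2l ?lee_fin ?(ltW b0)//.
have -> : (a ^+ d)%:E = (1 * a ^+ d)%:E :> \bar R by rewrite mul1r.
apply: (@cube_cover_volume _ _ p) => // [|x xa]; first exact: ltW.
pose z0 := Num.sqrt (s ^+ 2 - \sum_(j < d) x j ^+ 2).
pose z : 'rV[R]_d.+1 := \row_i (if i == ord0 then z0 else x i.-1).
have sumx : \sum_(j < d) x j ^+ 2 <= s ^+ 2.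
  apply: (@le_trans _ _ (\sum_(j < d) a ^+ 2)).
    apply: ler_sum => j _; have /andP[? ?] := xa j.
    by apply: lerXn2r; rewrite ?nnegrE// ltW.
  rewrite sumr_const card_ord -[leLHS]mulr_natl /a expr_div_n mulrCA.
  rewrite ler_piMr ?sqr_ge0// ler_pdivrMr ?exprn_gt0// mul1r -natrX ler_nat.
  by rewrite (leq_trans (leqnSn _))// leq_pmull.
have Sz : sphere s z.
  have zl j : z 0 (lift ord0 j) = x j by rewrite mxE.
  rewrite /sphere/= /enorm big_ord_recl (eq_bigr (fun j : 'I_d => x j ^+ 2)).
    rewrite mxE eqxx sqr_sqrtr ?subr_ge0//.
    by rewrite subrK sqrtr_sqr ger0_norm// ltW.
  by move=> j _; rewrite zl.
have [k _ Ukz] := SF _ Sz.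
have -> : 1%:E = (c k * \prod_(i < d) \1_(`[(p k i - r k), (p k i + r k)]) (x i))%:E :> \bar R.
  rewrite /c asboolT; last by exists z.
  rewrite mul1r big1// => i _; rewrite indicE mem_set//= in_itv/=.
  have Ukg : U k (xget 0 (U k)) by apply: (@xgetPex _ 0 (U k)); exists z.
  have : `|z 0 (inord i.+1) - p k i| <= r k.
    have -> : z 0 (inord i.+1) - p k i = (z - xget 0 (U k)) 0 (inord i.+1) by rewrite !mxE.
    apply: le_trans (ler_coord_enorm _ _) _.
    rewrite -lee_fin /r fineK.
      by apply: ereal_sup_ubound; exists z => //; exists (xget 0 (U k)).
    have Ud : (diam (U k) <= 1%:E)%E.
      by rewrite /U; case E : (F k) Ukz => [V|]//= _; exact: CF E.
    rewrite ge0_fin_numE; first by apply: le_lt_trans Ud _; rewrite ltry.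
    apply: le_trans (_ : (enorm (z - z))%:E <= _)%E.
      by rewrite lee_fin enorm_ge0.
    by apply: ereal_sup_ubound; exists z => //; exists z.
  rewrite mxE -val_eqE/= inordK ?ltnS//=.
  rewrite ler_norml => /andP[? ?]; apply/andP; split; lra.
apply: le_trans (nneseries_lim_ge k.+1 _) => //; last first.
  by move=> j _ _; rewrite lee_fin mulr_ge0// prodr_ge0.
rewrite big_mkord big_ord_recr/= leeDr// sume_ge0// => j _.
by rewrite lee_fin mulr_ge0// prodr_ge0.
Qed.

End sphere_positive.

(** * Integration over a sphere *)

Section sphere_integral.
Context {R : realType} (d : nat) (s : R).
Hypothesis s_gt0 : 0 < s.
Notation E := 'rV[R]_d.+1.
Notation H := [the {outer_measure set E -> \bar R} of @hausdorff R d.+1 d].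
Notation CT := (caratheodory_type H).
Notation mu := (H : {measure set CT -> \bar R}).
Notation S := (sphere s : set E).
Implicit Types f g : E -> R.

Definition sphere_integral f : R := cara_integral H S f.
Notation sint := sphere_integral.

Lemma measurable_closed (C : set E) : closed C -> measurable (C : set CT).
Proof. exact: caratheodory_closed. Qed.

Lemma measurable_continuous f : continuous f -> measurable_fun (setT : set CT) f.
Proof.
move=> cf; apply: (measurability _ (RGenOpens.measurableE R)).
move=> _ [_ [a [b ->] <-]]; rewrite setTI -[X in measurable X]setCK.
apply: measurableC; apply: measurable_closed; apply: open_closedC.
by move/continuousP: cf; apply; exact: interval_open.
Qed.

Lemma closed_sphere : closed S.
Proof.
have -> : S = (fun x : E => \sum_i x 0 i ^+ 2) @^-1` [set s ^+ 2].
  apply/seteqP; split=> x /=; first by move=> <-; rewrite sqr_enorm.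
  by rewrite /sphere/= /enorm => ->; rewrite sqrtr_sqr ger0_norm// ltW.
apply: closed_comp; last exact: closed_eq.
move=> x _; apply: (@continuous_sum R E) => i _ {}x.
apply: (@cvg_comp _ _ _ (fun y : E => y 0 i) (fun t : R => t ^+ 2)).
  exact: coord_continuous.
exact: exprn_continuous.
Qed.

Lemma measurable_sphere : measurable (S : set CT).
Proof. exact/measurable_closed/closed_sphere. Qed.

Lemma compact_sphere : compact S.
Proof.
apply: bounded_closed_compact closed_sphere.
exists s; split; first exact: num_real.
move=> M sM x Sx; apply: le_trans (ler_norm_enorm _) _.
by rewrite (_ : enorm x = s)// ltW.
Qed.

Lemma sint_integrable f : continuous f -> mu.-integrable S (EFin \o f).
Proof.
move=> cf; apply: measurable_bounded_integrable.
- exact: measurable_sphere.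
- exact: hausdorff_sphere_fin.
- by apply: measurable_funTS; exact: measurable_continuous.
- have /compact_bounded : compact (f @` S).
    by apply: continuous_compact compact_sphere; exact: continuous_subspaceT.
  move=> [M [Mr MP]]; exists M; split=> // x Mx y Sy.
  by apply: MP => //; exists y.
Qed.

Lemma sintD f g : continuous f -> continuous g ->
  sint (fun x => f x + g x) = sint f + sint g.
Proof.
move=> cf cg; apply: (@RintegralD _ CT R mu S f g);
  [exact: measurable_sphere|exact: sint_integrable..].
Qed.

Lemma sintZ (c : R) f : continuous f -> sint (fun x => c * f x) = c * sint f.
Proof.
move=> cf; apply: (@RintegralZl _ CT R mu S f c);
  [exact: measurable_sphere|exact: sint_integrable..].
Qed.

Lemma eq_sint f g : (forall x, S x -> f x = g x) -> sint f = sint g.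
Proof. by move=> fg; apply: eq_Rintegral => x /set_mem; exact: fg. Qed.

Lemma sint_cst (c : R) : sint (fun=> c) = c * sint (fun=> 1).
Proof.
rewrite /sphere_integral /cara_integral.
by rewrite !(Rintegral_cst mu measurable_sphere) mul1r.
Qed.

Lemma sint1 : sint (fun=> 1) = fine (hausdorff d S).
Proof. by rewrite /sphere_integral /cara_integral (Rintegral_cst mu measurable_sphere) mul1r. Qed.

Lemma sint1_gt0 : 0 < sint (fun=> 1).
Proof. by rewrite sint1 fine_gt0// hausdorff_sphere_gt0//= hausdorff_sphere_fin. Qed.

Lemma sint_sum (I : finType) (P : pred I) (F : I -> E -> R) :
  (forall i, continuous (F i)) ->
  sint (fun x => \sum_(i | P i) F i x) = \sum_(i | P i) sint (F i).
Proof.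
move=> cF.
suff : continuous (fun x => \sum_(i | P i) F i x) /\
    sint (fun x => \sum_(i | P i) F i x) = \sum_(i | P i) sint (F i) by case.
have sum0 (r : seq I) : continuous (fun x => \sum_(i <- r | P i) F i x).
  by apply: continuous_sum => i _; exact: cF.
split; first exact: sum0.
elim: (index_enum I) => [|i r IH].
  rewrite (_ : (fun _ => _) = fun=> 0); last by apply/funext => x; rewrite big_nil.
  by rewrite sint_cst mul0r big_nil.
rewrite big_cons -IH; case: ifP => Pi; last first.
  by apply: eq_sint => x _; rewrite big_cons Pi.
by rewrite -sintD//; apply: eq_sint => x _; rewrite big_cons Pi.
Qed.

Lemma sint_le_norm f (c : R) : continuous f -> (forall x, S x -> `|f x| <= c) ->
  `|sint f| <= c * sint (fun=> 1).
Proof.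
move=> cf fc; have mS := measurable_sphere; have If := sint_integrable cf.
apply: le_trans (le_normr_Rintegral mS If) _.
rewrite -sint_cst; apply: le_Rintegral => //.
  exact: (integrable_norm If).
by apply: sint_integrable; exact: cst_continuous.
Qed.

(** Change of variables: [rho] preserves the outer measure, hence the
    measurable sets, hence the measure. *)
Lemma sint_isometry (rho : E -> E) f : involutive rho ->
  (forall x y, enorm (rho x - rho y) = enorm (x - y)) ->
  (forall x, enorm (rho x) = enorm x) -> continuous f -> continuous (f \o rho) ->
  sint (f \o rho) = sint f.
Proof.
move=> rhoK rho_iso rho_norm cf cfr.
have mrho : measurable_fun (setT : set CT) (rho : CT -> CT).
  move=> _ A mA; rewrite setTI.
  suff : caratheodory_measurable H (rho @^-1` A) by [].
  have cA : caratheodory_measurable H A := mA.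
  have iso (Y : set E) : H Y = H (rho @^-1` Y).
    exact/esym/(hausdorff_isometry d rhoK rho_iso).
  move=> X; rewrite [LHS]iso [LHS]cA [X in (X + _)%E]iso [X in (_ + X)%E]iso.
  by congr (H _ + H _)%E; apply/seteqP; split=> x /=; rewrite ?rhoK.
have Srho : rho @^-1` S = S.
  by apply/seteqP; split=> x; rewrite /sphere/= rho_norm.
have key := @integral_pushforward _ _ CT CT R rho mrho mu S (EFin \o f).
rewrite Srho in key.
rewrite /sphere_integral /cara_integral /Rintegral; apply: (congr1 fine).
apply: etrans (esym (key _ _ _)) _.
- by apply/measurable_EFinP; exact: measurable_continuous.
- exact: (sint_integrable cfr).
- exact: measurable_sphere.
apply: eq_measure_integral => A _ _.
exact: (hausdorff_isometry d rhoK rho_iso).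
Qed.

End sphere_integral.

(** * Moments of a sphere and Bessel functions *)

Section dot_product.
Context {R : realType} {n : nat}.
Implicit Types x y z w : 'rV[R]_n.

Definition dotv x y : R := \sum_i x 0 i * y 0 i.

Lemma dotvC x y : dotv x y = dotv y x.
Proof. by apply: eq_bigr => i _; rewrite mulrC. Qed.

Lemma dotvDl x y z : dotv (x + y) z = dotv x z + dotv y z.
Proof. by rewrite /dotv -big_split; apply: eq_bigr => i _; rewrite mxE mulrDl. Qed.

Lemma dotvZl (a : R) x z : dotv (a *: x) z = a * dotv x z.
Proof. by rewrite /dotv mulr_sumr; apply: eq_bigr => i _; rewrite mxE mulrA. Qed.

Lemma dotvNl x z : dotv (- x) z = - dotv x z.
Proof. by rewrite -scaleN1r dotvZl mulN1r. Qed.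

Lemma dotvBl x y z : dotv (x - y) z = dotv x z - dotv y z.
Proof. by rewrite dotvDl dotvNl. Qed.

Lemma dotvDr x y z : dotv z (x + y) = dotv z x + dotv z y.
Proof. by rewrite !(dotvC z) dotvDl. Qed.

Lemma dotvZr (a : R) x z : dotv z (a *: x) = a * dotv z x.
Proof. by rewrite !(dotvC z) dotvZl. Qed.

Lemma dotvNr x y : dotv x (- y) = - dotv x y.
Proof. by rewrite dotvC dotvNl dotvC. Qed.

Lemma dotvBr x y z : dotv z (x - y) = dotv z x - dotv z y.
Proof. by rewrite !(dotvC z) dotvBl. Qed.

Lemma dotv_enorm x : dotv x x = enorm x ^+ 2.
Proof. by rewrite sqr_enorm; apply: eq_bigr => i _; rewrite expr2. Qed.

Lemma dotv_delta x i : dotv x (delta_mx 0 i) = x 0 i.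
Proof.
rewrite /dotv (bigD1 i)//= mxE !eqxx mulr1 big1 ?addr0// => j ji.
by rewrite mxE (negbTE ji) andbF mulr0.
Qed.

Lemma enorm_eq0 x : enorm x = 0 -> x = 0.
Proof.
move=> x0; apply/rowP => i; apply/eqP; rewrite mxE -normr_le0 -x0.
exact: ler_coord_enorm.
Qed.

Lemma continuous_dotv x : continuous (fun y => dotv y x).
Proof.
apply: (@continuous_sum R) => i _ y.
exact: (cvgM (@coord_continuous R 1 n 0 i y) (cvg_cst _)).
Qed.

Lemma continuous_dotv_comp (F : R -> R) y : continuous F ->
  continuous (fun x => F (dotv x y)).
Proof.
by move=> cF x; apply: continuous_comp; [exact: continuous_dotv|exact: cF].
Qed.

Arguments continuous_dotv_comp {F y} _ x.

(** At [w = 0] this is the identity, so that [reflection_swap] covers [x = y]. *)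
Definition reflection w x := x - (2 * dotv x w / dotv w w) *: w.

Lemma reflection_dotv w x y : dotv (reflection w x) y = dotv x (reflection w y).
Proof.
rewrite /reflection dotvBl dotvZl dotvBr dotvZr (dotvC w y).
by congr (_ - _); ring.
Qed.

Lemma reflectionK w : involutive (reflection w).
Proof.
move=> x; rewrite /reflection dotvBl dotvZl.
have [w0|w0] := eqVneq (dotv w w) 0.
  by rewrite w0 !invr0 !mulr0 !scale0r !subr0.
rewrite -addrA -opprD -scalerDl [X in X *: _](_ : _ = 0) ?scale0r ?subr0//.
by field.
Qed.

Lemma reflectionB w x y : reflection w x - reflection w y = reflection w (x - y).
Proof.
by rewrite /reflection dotvBl; apply/rowP => i; rewrite !mxE; ring.
Qed.

Lemma enorm_reflection w x : enorm (reflection w x) = enorm x.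
Proof.
apply/eqP; rewrite -(@eqrXn2 _ 2)// ?enorm_ge0// -!dotv_enorm.
by rewrite reflection_dotv reflectionK.
Qed.

(** Reflections alone act transitively on the vectors of a given norm. *)
Lemma reflection_swap x y : enorm x = enorm y -> reflection (x - y) x = y.
Proof.
move=> xy; have e := congr1 (fun a => a ^+ 2) xy; rewrite /= -!dotv_enorm in e.
have [w0|w0] := eqVneq (dotv (x - y) (x - y)) 0.
  have : x - y = 0.
    by apply: enorm_eq0; apply/eqP; rewrite -sqrf_eq0 -dotv_enorm w0.
  by move/eqP; rewrite subr_eq0 => /eqP ->; rewrite /reflection subrr scaler0 subr0.
rewrite /reflection [X in X *: _](_ : _ = 1) ?scale1r ?subKr//.
have -> : 2 * dotv x (x - y) = dotv (x - y) (x - y).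
  by rewrite !dotvBl !dotvBr (dotvC y x) -e; ring.
by rewrite divff.
Qed.

End dot_product.

Section moments.
Context {R : realType} (d : nat) (s : R).
Hypothesis s_gt0 : 0 < s.
Notation E := 'rV[R]_d.+1.
Notation sint := (@sphere_integral R d s).
Implicit Types (x y xi : E) (F : R -> R).

(** A reflection is self-adjoint, so that it moves from [y] to [xi]. *)
Lemma sint_rotation F xi eta : continuous F -> enorm xi = enorm eta ->
  sint (fun y => F (dotv y xi)) = sint (fun y => F (dotv y eta)).
Proof.
move=> cF xe; rewrite -(reflection_swap xe).
rewrite -(@sint_isometry R d s s_gt0 (reflection (xi - eta)) (fun y => F (dotv y xi))).
- by apply: eq_sint => y _ /=; rewrite reflection_dotv.
- exact: reflectionK.
- by move=> x y; rewrite reflectionB enorm_reflection.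
- exact: enorm_reflection.
- exact: continuous_dotv_comp.
- rewrite (_ : _ \o _ = fun y => F (dotv y (reflection (xi - eta) xi))).
    exact: continuous_dotv_comp.
  by apply/funext => y /=; rewrite reflection_dotv.
Qed.

Lemma sint_odd (f : E -> R) : continuous f -> (forall y, f (- y) = - f y) ->
  sint f = 0.
Proof.
move=> cf oddf.
have : sint (f \o -%R) = sint f.
  apply: sint_isometry => //.
  - exact: opprK.
  - by move=> x y; rewrite opprK addrC -enormN opprB.
  - exact: enormN.
  - by move=> y; apply: continuous_comp; [exact: opp_continuous|exact: cf].
rewrite (@eq_sint _ _ _ _ (fun y => -1 * f y)); last first.
  by move=> y _ /=; rewrite oddf mulN1r.
by rewrite sintZ// mulN1r => /eqP; rewrite -subr_eq0 -opprD oppr_eq0 -mulr2n mulrn_eq0/= => /eqP.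
Qed.

Definition moment k : R := sint (fun y => y 0 0 ^+ k.*2).

Lemma sint_dotv_even k xi :
  sint (fun y => dotv y xi ^+ k.*2) = dotv xi xi ^+ k * moment k.
Proof.
rewrite (@sint_rotation (fun t => t ^+ k.*2) xi (enorm xi *: delta_mx 0 0)).
- rewrite dotv_enorm -exprM mul2n -sintZ//; last first.
    move=> y; apply: (continuous_comp (f := fun z : E => z 0 0) (g := fun t : R => t ^+ k.*2)).
      exact: coord_continuous.
    exact: exprn_continuous.
  by apply: eq_sint => y _; rewrite dotvZr dotv_delta exprMn.
- exact: exprn_continuous.
- apply/eqP; rewrite -(@eqrXn2 _ 2)// ?enorm_ge0// -!dotv_enorm.
  by rewrite dotvZl dotvZr dotv_delta mxE !eqxx mulr1 dotv_enorm expr2.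
Qed.

Lemma poly_ext (p q : {poly R}) : (forall t, p.[t] = q.[t]) -> p = q.
Proof.
move=> pq; apply/eqP; rewrite -subr_eq0; apply: contraT => pq0.
have := @max_poly_roots _ (p - q) [seq i%:R | i <- iota 0 (size (p - q))] pq0.
rewrite size_map size_iota ltnn => h; apply: h.
  by apply/allP => t _; rewrite /root hornerD hornerN pq subrr.
by rewrite map_inj_uniq ?iota_uniq//; exact: (can_inj (@natrK R)).
Qed.

(** The hypothesis equates two polynomials in [t], and the conclusion compares
    their linear coefficients: a derivative under the integral sign. *)
Lemma sint_coef1 (f g h : E -> R) (m : nat) (q : {poly R}) :
  continuous f -> continuous g -> continuous h ->
  (forall t, sint (fun y => (f y + t * g y) ^+ m.+1 * h y) = q.[t]) ->
  m.+1%:R * sint (fun y => f y ^+ m * g y * h y) = q`_1.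
Proof.
move=> cf cg ch fq.
pose c (i : nat) : R := 'C(m.+1, i)%:R * sint (fun y => f y ^+ (m.+1 - i) * g y ^+ i * h y).
have cF i : continuous (fun y => f y ^+ (m.+1 - i) * g y ^+ i * h y).
  move=> y; have h1 := continuous_comp (cf y) (@exprn_continuous R (m.+1 - i) (f y)).
  have h2 := continuous_comp (cg y) (@exprn_continuous R i (g y)).
  exact: cvgM (cvgM h1 h2) (ch y).
have -> : q = \poly_(i < m.+2) c i.
  apply: poly_ext => t; rewrite -fq horner_poly.
  pose G (i : 'I_m.+2) y := t ^+ i * 'C(m.+1, i)%:R * (f y ^+ (m.+1 - i) * g y ^+ i * h y).
  rewrite [RHS](eq_bigr (fun i => sint (G i))); last first.
    by move=> i _; rewrite (sintZ s_gt0)// /c; ring.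
  rewrite -(sint_sum s_gt0 xpredT).
    apply: eq_sint => y _; rewrite exprDn mulr_suml; apply: eq_bigr => i _.
    rewrite -mulr_natl exprMn /G.
    by move: 'C(_, _)%:R (f y ^+ _) (t ^+ i) (g y ^+ i) => a b u v; ring.
  by move=> i y; exact: cvgM (cvg_cst _) (cF i y).
by rewrite coef_poly /c /= bin1 subSS subn0.
Qed.

(** The derivative of [sint_dotv_even] with respect to [xi 0 i]. *)
Lemma sint_coord_dotv k xi i :
  sint (fun y => y 0 i * dotv y xi ^+ k.*2.+1) = xi 0 i * dotv xi xi ^+ k * moment k.+1.
Proof.
pose q : {poly R} := ((dotv xi xi)%:P + (2 * xi 0 i)%:P * 'X + 'X^2) ^+ k.+1 * (moment k.+1)%:P.
have := @sint_coef1 (fun y => dotv y xi) (fun y => y 0 i) (fun=> 1) k.*2.+1 q.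
rewrite (_ : q`_1 = 2 * k.+1%:R * (xi 0 i * dotv xi xi ^+ k * moment k.+1)); last first.
  have -> : q`_1 = q^`().[0] by rewrite horner_coef0 coef_deriv.
  rewrite /q derivM derivC mulr0 addr0 deriv_exp !derivD derivM !derivC derivX derivXn /=.
  rewrite !(hornerE, hornerMn, horner_exp) /= -mulr_natl !expr0n /=.
  by rewrite ?mulr0 ?addr0; ring.
move=> key; apply: (@mulfI _ (2 * k.+1%:R)).
  by rewrite mulf_neq0 ?pnatr_eq0.
rewrite -key.
- rewrite -natrM mul2n doubleS; congr (_ * _).
  by apply: eq_sint => y _; rewrite mulr1 mulrC.
- exact: continuous_dotv.
- exact: coord_continuous.
- exact: cst_continuous.
move=> t; rewrite /q !(hornerE, horner_exp) /=.
transitivity (sint (fun y => dotv y (xi + t *: delta_mx 0 i) ^+ k.+1.*2)).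
  by apply: eq_sint => y _; rewrite mulr1 doubleS dotvDr dotvZr dotv_delta.
rewrite sint_dotv_even; congr (_ ^+ _ * _).
rewrite !(dotvDl, dotvDr, dotvZl, dotvZr) !dotv_delta mxE !eqxx.
by rewrite dotvC dotv_delta /=; ring.
Qed.

(** By rotation invariance, each mixed moment of [y_0 ^ (2k) * y_i ^ 2] with
    [i != 0] is [moment k.+1 / (2k + 1)], while [y_0 ^ (2k) * sum_i y_i ^ 2] is
    [s ^ 2 * y_0 ^ (2k)] on the sphere. *)
Lemma momentS k : (k.*2.+1 + d)%:R * moment k.+1 = k.*2.+1%:R * s ^+ 2 * moment k.
Proof.
have cc (i : 'I_d.+1) : continuous (fun y : E => y 0 i) by exact: coord_continuous.
have c0 m : continuous (fun y : E => y 0 0 ^+ m).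
  by move=> y; exact: (continuous_comp (cc 0 y) (@exprn_continuous R m (y 0 0))).
have mixed (i : 'I_d.+1) : i != 0 ->
    k.*2.+1%:R * sint (fun y => y 0 0 ^+ k.*2 * y 0 i ^+ 2) = moment k.+1.
  move=> i0.
  (* Differentiate [sint_coord_dotv] at [xi = e_0] in the direction [e_i]. *)
  pose q : {poly R} := 'X * ((1 + 'X^2) ^+ k * (moment k.+1)%:P).
  transitivity (q`_1); last first.
    rewrite coefXM /= -horner_coef0 !(hornerE, horner_exp) /=.
    by rewrite expr0n /= addr0 expr1n mul1r.
  rewrite -(@sint_coef1 (fun y => y 0 0) (fun y => y 0 i) (fun y => y 0 i) k.*2 q)//.
    by congr (_ * _); apply: eq_sint => y _; rewrite expr2 mulrA.
  move=> t; rewrite /q !(hornerE, horner_exp) /=.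
  have := sint_coord_dotv k (delta_mx 0 0 + t *: delta_mx 0 i) i.
  rewrite !(dotvDl, dotvDr, dotvZl, dotvZr) !dotv_delta !mxE !eqxx (negbTE i0).
  rewrite [0 == i]eq_sym (negbTE i0) /= !(mulr0, addr0, add0r, mulr1) -expr2 => <-.
  apply: eq_sint => y _; rewrite mulrC; congr (_ * _ ^+ _).
  by rewrite dotvDr dotvZr !dotv_delta.
rewrite -mulrA; have <- : sint (fun y => \sum_i y 0 0 ^+ k.*2 * y 0 i ^+ 2) = s ^+ 2 * moment k.
  rewrite -(sintZ s_gt0)//; apply: eq_sint => y Sy.
  by rewrite -mulr_sumr (sphere_sqr Sy) mulrC.
rewrite (sint_sum s_gt0 xpredT); last first.
  move=> i y; apply: (cvgM (c0 _ y)).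
  exact: (continuous_comp (cc i y) (@exprn_continuous R 2 (y 0 i))).
rewrite big_ord_recl mulrDr mulr_sumr.
under [X in _ = _ + X]eq_bigr => i _ do rewrite mixed//.
rewrite sumr_const card_ord natrD mulrDl; congr (_ + _).
  congr (_ * _); apply: eq_sint => y _.
  by rewrite -exprD addn2.
by rewrite mulr_natl.
Qed.

Lemma moment0_gt0 : 0 < moment 0.
Proof.
by rewrite /moment (_ : (fun _ => _) = fun=> 1) ?sint1_gt0//; apply/funext => y; rewrite expr0.
Qed.

Lemma moment_gt0 k : 0 < moment k.
Proof.
elim: k => [|k IH]; first exact: moment0_gt0.
have h : 0 < (k.*2.+1 + d)%:R :> R by rewrite ltr0n.
by rewrite -(pmulr_rgt0 _ h) momentS !mulr_gt0// ?ltr0n// exprn_gt0.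
Qed.

Lemma sint_coord_cos xi i : sint (fun y => y 0 i * cos (dotv y xi)) = 0.
Proof.
apply: sint_odd => [y|y].
  apply: (cvgM (@coord_continuous R 1 d.+1 0 i y)).
  exact: (continuous_dotv_comp (@continuous_cos R)).
by rewrite mxE dotvNl cosN mulNr.
Qed.

(** The terms of the series of [c] in [sint (y_i * sin (y . xi)) = xi_i * c], where
    [a = |xi| ^ 2]. *)
Definition sine_coeff (a : R) (k : nat) : R :=
  (-1) ^+ k / k.*2.+1`!%:R * a ^+ k * moment k.+1.

Lemma leq_fact_add m k : (k`! <= (k + m)`!)%N.
Proof.
elim: m => [|m IH]; first by rewrite addn0.
by rewrite addnS factS (leq_trans IH)// leq_pmull.
Qed.

Let b (Y : R) k : R := Y * exp_coeff (Y ^+ 2) k.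

(** The sine series is dominated on [[-Y, Y]] by the series of
    [Y * exp (Y ^ 2)], since [k! <= (2k + 1)!]. *)
Lemma sin_remainder (Y : R) : 0 <= Y -> exists2 e : nat -> R, e @ \oo --> 0 &
  forall N (y : R), `|y| <= Y -> `|sin y - series (sin_coeff' y) N| <= e N.
Proof.
move=> Y0.
have cb : cvgn (series (b Y)).
  rewrite (_ : b Y = Y *: exp_coeff (Y ^+ 2)).
    exact: is_cvg_seriesZ (is_cvg_series_exp_coeff _).
  by apply/funext.
exists (fun N => limn (series (b Y)) - series (b Y) N).
  rewrite -(subrr (limn (series (b Y)))); apply: cvgB => //; exact: cvg_cst.
have b0 k : 0 <= b Y k by rewrite mulr_ge0// divr_ge0// exprn_ge0// sqr_ge0.
have ble (y : R) k : `|y| <= Y -> `|sin_coeff' y k| <= b Y k.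
  move=> yY; rewrite /sin_coeff' normrM normfV normrM normr_nat.
  rewrite -exprnP normrX normrN1 expr1n mul1r normrX /b /exp_coeff /=.
  rewrite exprS -exprM mulrA mul2n.
  have key : (k`!%:R : R) <= k.*2.+1`!%:R by rewrite ler_nat -addnn -addSn addnC leq_fact_add.
  apply: ler_pM => //.
  - by rewrite ler_pM ?exprn_ge0// lerXn2r ?nnegrE.
  - by rewrite lef_pV2 ?posrE ?ltr0n ?fact_gt0.
move=> N y yY.
have step M : (N <= M)%N -> `|series (sin_coeff' y) M - series (sin_coeff' y) N| <=
    limn (series (b Y)) - series (b Y) N.
  move=> NM; rewrite sub_series_geq//; apply: le_trans (ler_norm_sum _ _ _) _.
  apply: (@le_trans _ _ (\sum_(N <= k < M) b Y k)).
    by apply: ler_sum => k _; exact: ble.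
  rewrite -sub_series_geq// lerD2r; apply: nondecreasing_cvgn_le => //.
  exact: (@nondecreasing_series _ (b Y) xpredT 0 (fun k _ _ => b0 k)).
have h : (fun M => series (sin_coeff' y) M - series (sin_coeff' y) N) @ \oo -->
    sin y - series (sin_coeff' y) N.
  by apply: cvgB; [exact: cvg_sin_coeff'|exact: cvg_cst].
apply: (cvgr_to_le (cvg_norm h)).
by near=> M; apply: step; near: M; exact: nbhs_infty_ge.
Unshelve. all: by end_near.
Qed.

Lemma sint_coord_sin_cvg xi i :
  xi 0 i * series (sine_coeff (dotv xi xi)) N @[N --> \oo] -->
  sint (fun y => y 0 i * sin (dotv y xi)).
Proof.
pose Y := s * \sum_i `|xi 0 i|.
have Y0 : 0 <= Y by rewrite mulr_ge0 ?sumr_ge0// ltW.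
have [e e0 eP] := sin_remainder Y0.
have dY y : sphere s y -> `|dotv y xi| <= Y.
  move=> Sy; apply: le_trans (ler_norm_sum _ _ _) _; rewrite /Y mulr_sumr.
  by apply: ler_sum => j _; rewrite normrM ler_wpM2r// sphere_coord.
have ci : continuous (fun y : E => y 0 i) by exact: coord_continuous.
have cs : continuous (fun y : E => y 0 i * sin (dotv y xi)).
  move=> y; have h := @continuous_dotv_comp _ _ sin xi (@continuous_sin R) y.
  exact: cvgM (ci y) h.
pose p N y := \sum_(k < N) (-1) ^+ k / k.*2.+1`!%:R * (y 0 i * dotv y xi ^+ k.*2.+1).
have cp k : continuous (fun y : E => y 0 i * dotv y xi ^+ k.*2.+1).
  move=> y; have h := @continuous_dotv_comp _ _ (fun t => t ^+ _) xi (@exprn_continuous R k.*2.+1) y.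
  exact: cvgM (ci y) h.
have cp' k : continuous (fun y : E => (-1) ^+ k / k.*2.+1`!%:R * (y 0 i * dotv y xi ^+ k.*2.+1)).
  by move=> y; exact: cvgM (cvg_cst _) (cp k y).
have pE N : sint (p N) = xi 0 i * series (sine_coeff (dotv xi xi)) N.
  rewrite (sint_sum s_gt0 xpredT) => [|k]; last exact: cp'.
  rewrite /series /= big_mkord mulr_sumr; apply: eq_bigr => k _.
  rewrite (sintZ s_gt0)// sint_coord_dotv /sine_coeff; ring.
have cpN N : continuous (p N) by apply: continuous_sum => k _; exact: cp'.
have err N : `|sint (fun y => y 0 i * sin (dotv y xi)) - sint (p N)| <=
    s * e N * sint (fun=> 1).
  have cm : continuous (fun y => -1 * p N y).
    by move=> y; exact: cvgM (cvg_cst _) (cpN N y).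
  rewrite -mulN1r -(sintZ s_gt0 _ (cpN N)) -(sintD s_gt0 cs cm).
  apply: (sint_le_norm s_gt0) => [y|y Sy]; first exact: cvgD (cs y) (cm y).
  have -> : y 0 i * sin (dotv y xi) + -1 * p N y =
      y 0 i * (sin (dotv y xi) - series (sin_coeff' (dotv y xi)) N).
    rewrite mulN1r mulrBr; congr (_ - _).
    rewrite /p /series /= big_mkord mulr_sumr; apply: eq_bigr => k _.
    by rewrite /sin_coeff' -exprnP; ring.
  by rewrite normrM ler_pM ?sphere_coord// eP// dY.
apply/cvgrPdist_le => /= eps eps0.
have e1 : (s * e N * sint (fun=> 1)) @[N --> \oo] --> 0.
  rewrite -[X in _ --> X](mul0r (sint (fun=> 1))); apply: cvgM; last exact: cvg_cst.
  rewrite -[X in _ --> X](mulr0 s); apply: cvgM; [exact: cvg_cst|exact: e0].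
move/cvgrPdist_le : e1 => /(_ _ eps0); apply: filterS => N.
rewrite sub0r normrN -pE => h; apply: le_trans (err N) _.
exact: le_trans (ler_norm _) h.
Qed.

Let nu : R := d.+1%:R / 2.

(** The recursion [momentS] is also the one of the coefficients of the Bessel
    series of order [nu]. *)
Lemma moment_Gamma k :
  moment k.+1 * (4 ^+ k * k`!%:R * Gamma (k%:R + nu + 1)) =
  k.*2.+1`!%:R * s ^+ k.*2 * (moment 1 * Gamma (nu + 1)).
Proof.
have nu0 : 0 < nu by rewrite divr_gt0.
elim: k => [|k IH]; first by rewrite !expr0 add0r fact0 !mulr1 !mul1r.
have -> : k.+1%:R + nu + 1 = (k%:R + nu + 1) + 1 by rewrite -natr1; ring.
rewrite [Gamma (_ + 1 + 1)]GammaS; last first.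
  by rewrite ltrDr ltr_wpDl.
have mS := momentS k.+1.
have e1 : (k.+1.*2.+1 + d)%:R = 2 * (k%:R + nu + 1) :> R.
  rewrite /nu addSn doubleS addSn -!natr1 natrD -mul2n natrM; by field.
rewrite e1 in mS; rewrite exprS factS natrM.
set G := Gamma _ in IH *; set t := _ + 1 in mS *.
transitivity (2 * t * moment k.+2 * (2 * k.+1%:R) * (4 ^+ k * k`!%:R * G)); first by ring.
rewrite mS.
transitivity (k.+1.*2.+1%:R * s ^+ 2 * (2 * k.+1%:R) *
    (moment k.+1 * (4 ^+ k * k`!%:R * G))); first by ring.
rewrite IH doubleS !factS !natrM -[2]/(2%:R) -natrM mul2n doubleS.
rewrite -[k.*2.+2]addn2 exprD; ring.
Qed.

Lemma sine_coeff_bessel xi k : 0 < enorm xi ->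
  sine_coeff (dotv xi xi) k =
  moment 1 * Gamma (nu + 1) / (s * enorm xi / 2) `^ nu *
  ((-1) ^+ k / (k`!%:R * Gamma (k%:R + nu + 1)) *
   (s * enorm xi / 2) `^ (k.*2%:R + nu)).
Proof.
move=> xi0; have z0 : 0 < s * enorm xi / 2 by rewrite divr_gt0// mulr_gt0.
have nu0 : 0 < nu by rewrite divr_gt0.
rewrite powRD ?(gt_eqF z0) ?implybT// powR_mulrn ?ltW//.
have p0 : (s * enorm xi / 2) `^ nu != 0 by rewrite gt_eqF// powR_gt0.
have G0 : Gamma (k%:R + nu + 1) != 0 :> R.
  by rewrite gt_eqF// Gamma_gt0// lerDr addr_ge0// ltW.
have f0 : k`!%:R != 0 :> R by rewrite pnatr_eq0 -lt0n fact_gt0.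
have f20 : k.*2.+1`!%:R != 0 :> R by rewrite pnatr_eq0 -lt0n fact_gt0.
have f4 : 4 ^+ k != 0 :> R by rewrite expf_neq0.
have Mk : moment k.+1 = k.*2.+1`!%:R * s ^+ k.*2 * (moment 1 * Gamma (nu + 1)) /
    (4 ^+ k * k`!%:R * Gamma (k%:R + nu + 1)).
  by rewrite -moment_Gamma mulfK// !mulf_neq0.
have zk : (s * enorm xi / 2) ^+ k.*2 = s ^+ k.*2 * enorm xi ^+ k.*2 / 4 ^+ k.
  by rewrite expr_div_n exprMn -mul2n (exprM 2) -natrX.
rewrite /sine_coeff Mk dotv_enorm -exprM mul2n zk.
move: (_ `^ nu) p0 (Gamma _) G0 (k`!%:R : R) f0 (_`!%:R : R) f20 (4 ^+ k : R) f4.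
move=> a a0 b' b0 u u0 v v0 w w0.
by field; rewrite a0 b0 u0 v0 w0.
Qed.

(** The Fourier transform of [y_i dS]: the factor [c] is a nonzero multiple of
    [besselJ nu (s |xi|) / (s |xi| / 2) ^ nu]. *)
Lemma sint_coord_sin xi : exists c,
  (forall i, sint (fun y => y 0 i * sin (dotv y xi)) = xi 0 i * c) /\
  (0 < enorm xi -> besselJ (d.+1%:R / 2) (s * enorm xi) != 0 -> c != 0).
Proof.
have [xi0|xi0] := eqVneq xi 0.
  exists 1; split=> [i|]; last first.
    rewrite xi0 /enorm big1 ?sqrtr0 ?ltxx// => i _.
    by rewrite mxE expr0n.
  rewrite (@eq_sint _ _ _ _ (fun=> 0)) => [|y _].
    by rewrite (sint_cst _ s_gt0) mul0r xi0 mxE mul0r.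
  by rewrite /dotv xi0 big1 ?sin0 ?mulr0// => j _; rewrite mxE mulr0.
have [i0 xii0] : exists i, xi 0 i != 0.
  apply: contrapT => /forallNP h; move/eqP: xi0; apply.
  by apply/rowP => i; rewrite mxE; apply: contrapT => /eqP; exact: h.
pose c := sint (fun y => y 0 i0 * sin (dotv y xi)) / xi 0 i0.
have cvgc : series (sine_coeff (dotv xi xi)) @ \oo --> c.
  rewrite /c mulrC.
  rewrite (_ : series _ = fun N => (xi 0 i0)^-1 * (xi 0 i0 * series (sine_coeff (dotv xi xi)) N)).
    by apply: cvgM; [exact: cvg_cst|exact: sint_coord_sin_cvg].
  by apply/funext => N; rewrite mulKf.
exists c; split=> [i|e0].
  have h : xi 0 i * series (sine_coeff (dotv xi xi)) N @[N --> \oo] --> xi 0 i * c.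
    by apply: cvgM; [exact: cvg_cst|exact: cvgc].
  exact: (@cvg_unique _ (@Rhausdorff R) _ _ _ _ (sint_coord_sin_cvg (xi:=xi) (i:=i)) h).
apply: contra_neq => c0.
pose L := moment 1 * Gamma (nu + 1) / (s * enorm xi / 2) `^ nu.
have L0 : L != 0.
  rewrite gt_eqF// divr_gt0 ?mulr_gt0 ?moment_gt0//.
    by rewrite Gamma_gt0// lerDr divr_ge0.
  by rewrite powR_gt0// divr_gt0// mulr_gt0.
rewrite /besselJ.
have h : L^-1 * series (sine_coeff (dotv xi xi)) N @[N --> \oo] --> L^-1 * c.
  by apply: cvgM; [exact: cvg_cst|exact: cvgc].
rewrite c0 mulr0 in h.
rewrite -[RHS](cvg_lim _ h)//.
rewrite [X in limn X](_ : _ =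
    fun N => L^-1 * series (sine_coeff (dotv xi xi)) N)//; apply/funext => N.
rewrite /series /= mulr_sumr; apply: eq_bigr => k _.
by rewrite sine_coeff_bessel// -/L mulrA mulVf// mul1r.
Qed.

End moments.

(** * Continuous periodic functions *)

Section periodic_functions.
Context {R : realType} {n : nat}.
Notation E := 'rV[R]_n.
Implicit Types (f g : E -> R) (x y a : E).

Lemma row_norm_le x (c : R) : 0 <= c -> (forall i, `|x 0 i| <= c) -> `|x| <= c.
Proof.
move=> c0 h; rewrite [leLHS]mx_normrE; apply/bigmax_leP; split=> // -[i j] _ /=.
by rewrite ord1.
Qed.

Definition zperiodic f := forall x i, f (x + delta_mx 0 i) = f x.

Definition cperiodic f := zperiodic f /\ continuous f.

Lemma zperiodic_int f x (m : 'rV[int]_n) : zperiodic f -> f (x + map_mx intr m) = f x.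
Proof.
move=> pf.
have step i (k : int) z : f (z + k%:~R *: delta_mx 0 i) = f z.
  have pos (j : nat) y : f (y + j%:R *: delta_mx 0 i) = f y.
    rewrite scaler_nat; apply: periodicn => y'; exact: pf.
  case: (intP k) => [|j|j].
  - by rewrite scale0r addr0.
  - exact: pos.
  - by rewrite mulrNz scaleNr -[LHS](pos j.+1) subrK.
rewrite (row_sum_delta (map_mx intr m)).
elim: (index_enum _) x => [|i r IH] x; first by rewrite big_nil addr0.
by rewrite big_cons addrA IH mxE step.
Qed.

Definition int_part x : 'rV[int]_n := \row_i Num.floor (x 0 i).

Lemma frac_part x i : 0 <= (x - map_mx intr (int_part x)) 0 i < 1.
Proof.
rewrite !mxE subr_ge0 ltrBlDl; have := floor_itv (x 0 i).
by rewrite intrD addrC.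
Qed.

(** Uniform continuity on a compact period, extended by translation. *)
Lemma cperiodic_ucont f : cperiodic f -> forall e : R, 0 < e ->
  exists2 del : R, 0 < del & forall x y, `|x - y| <= del -> `|f x - f y| <= e.
Proof.
move=> [pf cf] e e0.
pose K : set E := [set v : E | forall i, `[0, 1]%classic (v 0 i)].
have cK : compact K by apply: (rV_compact (fun=> @segment_compact R 0 1)).
have := (compact_near_coveringP K).1 cK R (0^'+)
  (fun del x => forall y, `|x - y| <= del -> `|f x - f y| <= e) _.
case.
  move=> x Kx.
  have /cvgrPdist_le /(_ (e / 2)) := cf x.
  rewrite divr_gt0// => /(_ isT) /nbhs_ballP[r /= r0 rP].
  exists (ball x (r / 2), [set t : R | t < r / 2]).
    split=> /=; first by apply: nbhsx_ballx; rewrite divr_gt0.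
    by apply: nbhs_right_lt; rewrite divr_gt0.
  move=> [x' t] [/= xx' tr] y x'y.
  have b1 : ball x r x'.
    by apply: le_ball xx'; lra.
  have b2 : ball x r y.
    rewrite mx_norm_ball /ball_/= in xx' *.
    have := ler_distD x' x y; lra.
  have := rP _ b1; have := rP _ b2; rewrite /=.
  have := ler_distD (f x) (f x') (f y); rewrite [`|f x' - f x|]distrC; lra.
move=> r /= r0 rP.
exists (r / 2); first by rewrite divr_gt0.
move=> x y xy; pose m := int_part x.
have r2 : 0 < r / 2 by rewrite divr_gt0.
rewrite -(zperiodic_int x (- m) pf) -(zperiodic_int y (- m) pf).
apply: (rP (r / 2)) => //=.
- rewrite /ball_/= sub0r normrN gtr0_norm//; lra.
- by move=> i /=; rewrite in_itv/= map_mxN; have /andP[-> /ltW ->] := frac_part x i.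
- by rewrite opprD addrACA subrr addr0.
Qed.

Lemma cperiodic_bounded f : cperiodic f -> exists2 B : R, 0 <= B & forall x, `|f x| <= B.
Proof.
move=> [pf cf].
pose K : set E := [set v : E | forall i, `[0, 1]%classic (v 0 i)].
have cK : compact K by apply: (rV_compact (fun=> @segment_compact R 0 1)).
have /compact_bounded : compact (f @` K).
  by apply: continuous_compact cK; exact: continuous_subspaceT.
move=> [M [Mr MP]]; exists (`|M| + 1); first by rewrite addr_ge0.
move=> x; rewrite -(zperiodic_int x (- int_part x) pf); apply: MP.
  by rewrite ltr_pwDr// ler_norm.
exists (x + map_mx intr (- int_part x)) => // i /=.
rewrite in_itv/= map_mxN.
by have /andP[h1 h2] := frac_part x i; rewrite h1 ltW.
Qed.

Lemma cperiodicD f g : cperiodic f -> cperiodic g -> cperiodic (fun x => f x + g x).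
Proof.
move=> [pf cf] [pg cg]; split=> [x i|x]; first by rewrite pf pg.
exact: cvgD (cf x) (cg x).
Qed.

Lemma cperiodicM f g : cperiodic f -> cperiodic g -> cperiodic (fun x => f x * g x).
Proof.
move=> [pf cf] [pg cg]; split=> [x i|x]; first by rewrite pf pg.
exact: cvgM (cf x) (cg x).
Qed.

Lemma cperiodic_cst (c : R) : cperiodic (fun=> c).
Proof. by split; [|exact: cst_continuous]. Qed.

Lemma cperiodicZ (c : R) f : cperiodic f -> cperiodic (fun x => c * f x).
Proof. exact: cperiodicM (cperiodic_cst c). Qed.

Lemma cperiodicN f : cperiodic f -> cperiodic (fun x => - f x).
Proof. by move=> /(cperiodicZ (-1)); under eq_fun do rewrite mulN1r. Qed.

Lemma cperiodicX f k : cperiodic f -> cperiodic (fun x => f x ^+ k).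
Proof.
move=> tf; elim: k => [|k IH].
  by under eq_fun do rewrite expr0; exact: cperiodic_cst.
by under eq_fun do rewrite exprS; exact: cperiodicM.
Qed.

Lemma cperiodic_sum (I : finType) (F : I -> E -> R) :
  (forall i, cperiodic (F i)) -> cperiodic (fun x => \sum_i F i x).
Proof.
move=> tF; split=> [x i|]; first by apply: eq_bigr => j _; rewrite (tF j).1.
by apply: continuous_sum => i _; exact: (tF i).2.
Qed.

Lemma cperiodic_shift f a : cperiodic f -> cperiodic (fun x => f (x + a)).
Proof.
move=> [pf cf]; split=> [x i|x]; first by rewrite addrAC pf.
apply: (@continuous_comp _ _ _ (fun z : E => z + a) f); last exact: cf.
exact: cvgD (@cvg_id _ _) (cvg_cst _).
Qed.

End periodic_functions.

(** * The mean of a continuous periodic function *)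

Section mean.
Context {R : realType} {n : nat}.
Notation E := 'rV[R]_n.
Implicit Types (f g : E -> R) (x y a : E).

Definition grid_point N (k : 'rV['I_N.+1]_n) : E :=
  \row_i ((k 0 i)%:R / N.+1%:R).

(** Riemann sums: on periodic functions they are invariant under the translations
    of the grid, and so nearly invariant under all translations. *)
Definition grid_mean N f : R :=
  (#|{: 'rV['I_N.+1]_n}|%:R)^-1 * \sum_k f (@grid_point N k).

Let card_gt0 N : 0 < #|{: 'rV['I_N.+1]_n}|%:R :> R.
Proof. by rewrite ltr0n; apply/card_gt0P; exists 0. Qed.

Lemma grid_meanD N f g :
  grid_mean N (fun x => f x + g x) = grid_mean N f + grid_mean N g.
Proof. by rewrite /grid_mean big_split mulrDr. Qed.

Lemma grid_meanZ N (c : R) f : grid_mean N (fun x => c * f x) = c * grid_mean N f.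
Proof. by rewrite /grid_mean -mulr_sumr mulrCA. Qed.

Lemma grid_mean_cst N (c : R) : grid_mean N (fun=> c) = c.
Proof.
by rewrite /grid_mean sumr_const -[c *+ _]mulr_natl mulKf// gt_eqF// card_gt0.
Qed.

Lemma grid_mean_le N f g : (forall x, f x <= g x) -> grid_mean N f <= grid_mean N g.
Proof.
move=> fg; rewrite ler_wpM2l ?invr_ge0 ?(ltW (card_gt0 N))//.
by apply: ler_sum.
Qed.

Lemma grid_meanB N f g :
  grid_mean N (fun x => f x - g x) = grid_mean N f - grid_mean N g.
Proof.
rewrite grid_meanD; congr (_ + _); rewrite -mulN1r -grid_meanZ.
by congr grid_mean; apply/funext => x; rewrite mulN1r.
Qed.

Lemma grid_mean_norm N f (c : R) : (forall x, `|f x| <= c) -> `|grid_mean N f| <= c.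
Proof.
move=> fc; rewrite ler_norml; apply/andP; split.
  rewrite -(grid_mean_cst N (- c)); apply: grid_mean_le => x.
  by have := fc x; rewrite ler_norml => /andP[].
rewrite -(grid_mean_cst N c); apply: grid_mean_le => x.
by have := fc x; rewrite ler_norml => /andP[].
Qed.

Lemma grid_mean_dist N f g (c : R) : (forall x, `|f x - g x| <= c) ->
  `|grid_mean N f - grid_mean N g| <= c.
Proof. by move=> h; rewrite -grid_meanB; exact: grid_mean_norm. Qed.

Lemma grid_mean_shift_grid N f (j : 'rV['I_N.+1]_n) : zperiodic f ->
  grid_mean N (fun x => f (x + grid_point j)) = grid_mean N f.
Proof.
move=> pf; rewrite /grid_mean; congr (_ * _).
rewrite [RHS](reindex_inj (addIr j)); apply: eq_bigr => k _ /=.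
pose m : 'rV[int]_n := \row_i ((k 0 i + j 0 i) %/ N.+1)%:Z.
rewrite -[RHS](zperiodic_int _ m pf); congr f; apply/rowP => i.
have := divn_eq (k 0 i + j 0 i) N.+1.
rewrite !mxE /=.
have N0 : N.+1%:R != 0 :> R by rewrite pnatr_eq0.
move=> e; apply: (mulIf N0); rewrite !mulrDl !divfK//.
by rewrite -pmulrn -natrM -!natrD; congr (_%:R); rewrite {1}e addnC.
Qed.

Lemma grid_decomp N a : exists (m : 'rV[int]_n) (j : 'rV['I_N.+1]_n) (r : E),
  a = r + grid_point j + map_mx intr m /\ `|r| <= N.+1%:R^-1.
Proof.
pose fr := a - map_mx intr (int_part a).
have N0 : 0 < N.+1%:R :> R by rewrite ltr0n.
pose j : 'rV['I_N.+1]_n := \row_i inord (Num.trunc (fr 0 i * N.+1%:R)).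
pose r := fr - grid_point j.
exists (int_part a), j, r; split; first by rewrite !subrK.
apply: row_norm_le => [|i]; first by rewrite invr_ge0 ltW.
have /andP[f0 f1] := frac_part a i; rewrite -/fr in f0 f1.
have z0 : 0 <= fr 0 i * N.+1%:R by rewrite mulr_ge0// ltW.
have /andP[t1 t2] := trunc_itv z0.
have -> : r 0 i = fr 0 i - (Num.trunc (fr 0 i * N.+1%:R))%:R / N.+1%:R.
  have jE : j 0 i = Num.trunc (fr 0 i * N.+1%:R) :> nat.
    rewrite mxE inordK// -(ltr_nat R); apply: le_lt_trans t1 _.
    by rewrite gtr_pMl.
  by rewrite -jE [LHS]mxE; congr (_ + _); rewrite !mxE.
move: t1 t2; set t := Num.trunc _ => t1 t2.
have -> : fr 0 i - t%:R / N.+1%:R = (fr 0 i * N.+1%:R - t%:R) / N.+1%:R.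
  by field; rewrite gt_eqF.
rewrite normrM normfV (gtr0_norm N0) ger0_norm ?subr_ge0//.
by rewrite ler_piMl ?invr_ge0 ?(ltW N0)//; move: t2; rewrite -[t.+1%:R]natr1; lra.
Qed.

Lemma grid_mean_shift N f a (e del : R) : zperiodic f ->
  (forall x y, `|x - y| <= del -> `|f x - f y| <= e) -> N.+1%:R^-1 <= del ->
  `|grid_mean N (fun x => f (x + a)) - grid_mean N f| <= e.
Proof.
move=> pf uf Ndel; have [m [j [r [-> rN]]]] := grid_decomp N a.
have -> : grid_mean N (fun x => f (x + (r + grid_point j + map_mx intr m))) =
    grid_mean N (fun x => f (x + r)).
  rewrite -(@grid_mean_shift_grid N (fun x => f (x + r)) j).
    by congr grid_mean; apply/funext => x; rewrite !addrA zperiodic_int// addrAC.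
  by move=> x i; rewrite addrAC pf.
apply: grid_mean_dist => x; apply: uf.
by rewrite addrAC subrr add0r (le_trans rN).
Qed.

(** The double mean over both grids is close to each of the two means, which
    replaces a common refinement of the grids. *)
Lemma grid_mean_cauchy N M f (e del : R) : zperiodic f ->
  (forall x y, `|x - y| <= del -> `|f x - f y| <= e) ->
  N.+1%:R^-1 <= del -> M.+1%:R^-1 <= del ->
  `|grid_mean N f - grid_mean M f| <= 2 * e.
Proof.
move=> pf uf Nd Md.
(* The double mean can be taken in either order. *)
pose B := grid_mean N (fun x => grid_mean M (fun y => f (y + x))).
have BM : `|B - grid_mean M f| <= e.
  rewrite -(grid_mean_cst N (grid_mean M f)); apply: grid_mean_dist => x.
  exact: grid_mean_shift uf Md.
have BN : `|B - grid_mean N f| <= e.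
  have -> : B = grid_mean M (fun y => grid_mean N (fun x => f (x + y))).
    rewrite /B /grid_mean -!mulr_sumr mulrCA; congr (_ * (_ * _)).
    by rewrite exchange_big; apply: eq_bigr => x _; apply: eq_bigr => y _; rewrite addrC.
  rewrite -(grid_mean_cst M (grid_mean N f)); apply: grid_mean_dist => x.
  exact: grid_mean_shift uf Nd.
have := ler_distD B (grid_mean N f) (grid_mean M f).
rewrite distrC in BN; lra.
Qed.

(** The integral over the torus, as a limit of Riemann sums. *)
Definition mean f : R := limn (fun N => grid_mean N f).

Let near_inv (del : R) : 0 < del -> \forall N \near \oo, N.+1%:R^-1 <= del.
Proof. by move=> d0; have := near_infty_natSinv_lt (PosNum d0); apply: filterS => N /ltW. Qed.

Lemma grid_mean_cvg f : cperiodic f -> grid_mean N f @[N --> \oo] --> mean f.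
Proof.
move=> tf; apply/cauchy_cvgP; apply: cauchy_exP => e e0.
have e4 : 0 < e / 4 by rewrite divr_gt0.
have [del d0 uf] := cperiodic_ucont tf e4.
have [N0 _ N0P] := near_inv d0.
exists (grid_mean N0 f); exists N0 => // N N0N /=.
rewrite /ball/=; apply: le_lt_trans (grid_mean_cauchy tf.1 uf _ _) _.
- exact: N0P N0 (leqnn _).
- exact: N0P.
- lra.
Qed.

Lemma mean_approx f (e del : R) : cperiodic f ->
  (forall x y, `|x - y| <= del -> `|f x - f y| <= e) -> forall N,
  N.+1%:R^-1 <= del -> `|mean f - grid_mean N f| <= 2 * e.
Proof.
move=> tf uf N Nd.
have d0 : 0 < del by apply: lt_le_trans Nd; rewrite invr_gt0.
have h : (fun M => grid_mean M f - grid_mean N f) @ \oo --> mean f - grid_mean N f.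
  by apply: cvgB; [exact: grid_mean_cvg|exact: cvg_cst].
apply: (cvgr_to_le (cvg_norm h)).
by apply: filterS (near_inv d0) => M Md; exact: grid_mean_cauchy tf.1 uf Md Nd.
Qed.

Lemma meanD f g : cperiodic f -> cperiodic g -> mean (fun x => f x + g x) = mean f + mean g.
Proof.
move=> tf tg; apply/cvg_lim => //; under eq_fun do rewrite grid_meanD.
by apply: cvgD; exact: grid_mean_cvg.
Qed.

Lemma meanZ (c : R) f : cperiodic f -> mean (fun x => c * f x) = c * mean f.
Proof.
move=> tf; apply/cvg_lim => //; under eq_fun do rewrite grid_meanZ.
by apply: cvgM; [exact: cvg_cst|exact: grid_mean_cvg].
Qed.

Lemma meanB f g : cperiodic f -> cperiodic g -> mean (fun x => f x - g x) = mean f - mean g.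
Proof.
move=> tf tg; apply/cvg_lim => //; under eq_fun do rewrite grid_meanB.
by apply: cvgB; exact: grid_mean_cvg.
Qed.

Lemma mean_cst (c : R) : mean (fun=> c) = c.
Proof. by apply/cvg_lim => //; under eq_fun do rewrite grid_mean_cst; exact: cvg_cst. Qed.

Lemma mean_sum (I : finType) (F : I -> E -> R) : (forall i, cperiodic (F i)) ->
  mean (fun x => \sum_i F i x) = \sum_i mean (F i).
Proof.
move=> tF; pose G (r : seq I) x := \sum_(i <- r) F i x.
have tG r : cperiodic (G r).
  rewrite /G; elim: r => [|i r IH].
    by under eq_fun do rewrite big_nil; exact: cperiodic_cst.
  by under eq_fun do rewrite big_cons; exact: cperiodicD.
rewrite -/(G (index_enum I)); elim: (index_enum I) => [|i r IH].
  by rewrite /G big_nil; under eq_fun do rewrite big_nil; rewrite mean_cst.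
rewrite /G big_cons; under eq_fun do rewrite big_cons.
by rewrite (meanD (tF i) (tG r)) IH.
Qed.

Lemma mean_le f g : cperiodic f -> cperiodic g -> (forall x, f x <= g x) -> mean f <= mean g.
Proof.
move=> tf tg fg; apply: (ler_cvg_to (grid_mean_cvg tf) (grid_mean_cvg tg)).
by apply: nearW => N; exact: grid_mean_le.
Qed.

Lemma mean_norm f (c : R) : cperiodic f -> (forall x, `|f x| <= c) -> `|mean f| <= c.
Proof.
move=> tf fc; apply: (cvgr_to_le (cvg_norm (grid_mean_cvg tf))).
by apply: nearW => N; exact: grid_mean_norm.
Qed.

Lemma mean_shift f a : cperiodic f -> mean (fun x => f (x + a)) = mean f.
Proof.
move=> tf; apply/eqP; rewrite -subr_eq0 -normr_le0; apply/ler_addgt0Pl => e e0.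
rewrite addr0; have [del d0 uf] := cperiodic_ucont tf e0.
have h : (fun N => grid_mean N (fun x => f (x + a)) - grid_mean N f) @ \oo -->
    mean (fun x => f (x + a)) - mean f.
  by apply: cvgB; apply: grid_mean_cvg => //; exact: cperiodic_shift.
apply: (cvgr_to_le (cvg_norm h)).
by apply: filterS (near_inv d0) => N Nd; exact: grid_mean_shift tf.1 uf Nd.
Qed.

End mean.

(** * Fourier coefficients of derivatives *)

Section mean_derivative.
Context {R : realType} {n : nat}.
Notation E := 'rV[R]_n.
Implicit Types (f g u : E -> R) (x y a v : E) (i : 'I_n).

Lemma is_derive_line f x v (t : R) : derivable f (x + t *: v) v ->
  is_derive t 1 (fun t : R => f (x + t *: v)) ('D_v f (x + t *: v)).
Proof.
move=> df.
have e : (fun h : R => h^-1 *: (f (x + (h *: 1 + t) *: v) - f (x + t *: v))) =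
         (fun h : R => h^-1 *: (f (h *: v + (x + t *: v)) - f (x + t *: v))).
  apply/funext => h; congr (_ *: (f _ - _)).
  by rewrite scalerDl addrCA /GRing.scale/= mulr1.
by split; [rewrite /derivable e|rewrite /derive e].
Qed.

Lemma cperiodic_derive f v : cperiodic f -> continuous ('D_v f) -> cperiodic ('D_v f).
Proof.
move=> [pf cf] cD; split=> // x i; rewrite /derive.
have -> // : (fun h : R => h^-1 *: (f (h *: v + (x + delta_mx 0 i)) - f (x + delta_mx 0 i))) =
             (fun h : R => h^-1 *: (f (h *: v + x) - f x)).
by apply/funext => h /=; rewrite addrA !pf.
Qed.

(** Difference quotients have mean zero by translation invariance, and they
    converge uniformly to the derivative by the mean value theorem. *)
Lemma mean_derive f v : cperiodic f -> (forall x, derivable f x v) ->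
  continuous ('D_v f) -> mean ('D_v f) = 0.
Proof.
move=> tf df cD; have tD := cperiodic_derive tf cD.
apply/eqP; rewrite -normr_le0; apply/ler_addgt0Pl => e e0; rewrite addr0.
have [del d0 uD] := cperiodic_ucont tD e0.
pose h := del / (1 + `|v|).
have h0 : 0 < h by rewrite divr_gt0// ltr_pwDl.
pose q x := h^-1 * (f (x + h *: v) - f x).
have tq : cperiodic q.
  apply: cperiodicZ; apply: cperiodicD; [exact: cperiodic_shift|exact: cperiodicN].
have q0 : mean q = 0.
  rewrite /q meanZ; last by apply: cperiodicD; [exact: cperiodic_shift|exact: cperiodicN].
  by rewrite meanB ?mean_shift ?subrr ?mulr0//; exact: cperiodic_shift.
have -> : mean ('D_v f) = mean (fun x => 'D_v f x - q x) by rewrite meanB// q0 subr0.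
apply: mean_norm => [|x]; first by apply: cperiodicD => //; exact: cperiodicN.
have dl (t : R) : is_derive t 1 (fun t : R => f (x + t *: v)) ('D_v f (x + t *: v)).
  exact: is_derive_line.
have [|c] := @MVT R (fun t : R => f (x + t *: v)) (fun t => 'D_v f (x + t *: v)) 0 h h0 (fun t _ => dl t).
  apply: continuous_subspaceT => t.
  by have [/derivable1_diffP/differentiable_continuous] := dl t.
rewrite in_itv/= scale0r addr0 subr0 => /andP[c0 ch] fc.
rewrite /q fc mulrC mulfK ?gt_eqF//; apply: uD.
rewrite opprD addrA subrr add0r normrN normrZ gtr0_norm//.
apply: (@le_trans _ _ (h * `|v|)); first by rewrite ler_wpM2r// ltW.
by rewrite /h mulrAC ler_pdivrMr ?ltr_pwDl// ler_wpM2l ?lerDr// ltW.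
Qed.

End mean_derivative.

Section waves.
Context {R : realType} {n : nat}.
Notation E := 'rV[R]_n.
Implicit Types (f g u : E -> R) (x y a v : E) (i : 'I_n) (m : 'rV[int]_n).

Definition freq m : E := (2 * pi) *: map_mx intr m.
Definition cosw m x : R := cos (dotv x (freq m)).
Definition sinw m x : R := sin (dotv x (freq m)).

Lemma dotv_delta_freq m i : dotv (delta_mx 0 i) (freq m) = (2 * pi) * (m 0 i)%:~R.
Proof. by rewrite dotvC dotv_delta !mxE. Qed.

Lemma periodic_int (F : R -> R) : periodic F (pi *+ 2) ->
  forall (k : int) t, F (t + 2 * pi * k%:~R) = F t.
Proof.
move=> pF k t; have pos (j : nat) (z : R) : F (z + 2 * pi * j%:R) = F z.
  by rewrite -(periodicn pF j z) mulr_natr mulr_natl.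
case: (intP k) => [|j|j].
- by rewrite mulr0 addr0.
- exact: pos.
- by rewrite mulrNz mulrN -[LHS](pos j.+1) subrK.
Qed.

Lemma cperiodic_cosw m : cperiodic (cosw m).
Proof.
split=> [x i|]; last exact: continuous_dotv_comp (@continuous_cos R).
by rewrite /cosw dotvDl dotv_delta_freq periodic_int//; exact: cosD2pi.
Qed.

Lemma cperiodic_sinw m : cperiodic (sinw m).
Proof.
split=> [x i|]; last exact: continuous_dotv_comp (@continuous_sin R).
by rewrite /sinw dotvDl dotv_delta_freq periodic_int//; exact: sinD2pi.
Qed.

Lemma freqD m m' : freq (m + m') = freq m + freq m'.
Proof. by rewrite /freq map_mxD scalerDr. Qed.

Lemma freqN m : freq (- m) = - freq m.
Proof. by rewrite /freq map_mxN scalerN. Qed.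

Lemma coswD m m' x : cosw (m + m') x = cosw m x * cosw m' x - sinw m x * sinw m' x.
Proof. by rewrite /cosw freqD dotvDr cosD. Qed.

Lemma sinwD m m' x : sinw (m + m') x = sinw m x * cosw m' x + cosw m x * sinw m' x.
Proof. by rewrite /sinw freqD dotvDr sinD. Qed.

Lemma coswN m x : cosw (- m) x = cosw m x.
Proof. by rewrite /cosw freqN dotvNr cosN. Qed.

Lemma sinwN m x : sinw (- m) x = - sinw m x.
Proof. by rewrite /sinw freqN dotvNr sinN. Qed.

Lemma is_derive_wave (F F' : R -> R) m x i :
  (forall t : R, is_derive t 1 F (F' t)) ->
  is_derive x (delta_mx 0 i) (fun y => F (dotv y (freq m))) (freq m 0 i * F' (dotv x (freq m))).
Proof.
move=> dF; set c := freq m 0 i; set b := dotv x _.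
have e : (fun h : R => h^-1 *: (F (dotv (h *: delta_mx 0 i + x) (freq m)) - F b)) =
         (fun h : R => h^-1 *: (F (b + (h *: 1) * c) - F b)).
  apply/funext => h; congr (_ *: (F _ - _)).
  by rewrite dotvDl dotvZl (dotvC _ (freq m)) dotv_delta addrC /GRing.scale/= mulr1.
have dG : is_derive (0 : R) 1 (fun t : R => F (b + t * c)) (c * F' b).
  have := dF (b + 0 * c) => ?.
  apply: is_derive_eq.
  rewrite mul0r addr0 /GRing.scale/=. ring.
have [d1 d2] := dG.
have e2 : (fun h : R => h^-1 *: (F (b + (h *: 1) * c) - F b)) =
   (fun h : R => h^-1 *: (F (b + (h *: 1 + 0) * c) - F (b + 0 * c))).
  by apply/funext => h; rewrite addr0 mul0r addr0.
by split; [rewrite /derivable e e2|rewrite /derive e e2].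
Qed.

(** Integration by parts on the torus: the derivative of [u] times the wave has
    mean zero. *)
Lemma mean_parts u (F F' : R -> R) m i : cperiodic u ->
  (forall x, derivable u x (delta_mx 0 i)) -> continuous ('D_(delta_mx 0 i) u) ->
  cperiodic (fun y => F (dotv y (freq m))) -> cperiodic (fun y => F' (dotv y (freq m))) ->
  (forall t : R, is_derive t 1 F (F' t)) ->
  mean (fun x => 'D_(delta_mx 0 i) u x * F (dotv x (freq m))) =
  - freq m 0 i * mean (fun x => u x * F' (dotv x (freq m))).
Proof.
move=> tu du cD tF tF' dF; set e := delta_mx 0 i in du cD *.
pose w x := F (dotv x (freq m)).
have tD := cperiodic_derive tu cD.
have dw x : is_derive x e w (freq m 0 i * F' (dotv x (freq m))).
  exact: is_derive_wave.
have dP x : is_derive x e (fun y => u y * w y)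
    ('D_e u x * w x + freq m 0 i * (u x * F' (dotv x (freq m)))).
  have ? := DeriveDef (du x) erefl.
  have ? := dw x.
  apply: is_derive_eq; rewrite /GRing.scale/=; ring.
have DE : 'D_e (fun y => u y * w y) =
    fun x => 'D_e u x * w x + freq m 0 i * (u x * F' (dotv x (freq m))).
  by apply/funext => x; have ? := dP x; exact: derive_val.
have t1 : cperiodic (fun x => 'D_e u x * w x) by exact: cperiodicM.
have t2 : cperiodic (fun x => u x * F' (dotv x (freq m))) by exact: cperiodicM.
have t3 := cperiodicD t1 (cperiodicZ (freq m 0 i) t2).
have : mean ('D_e (fun y => u y * w y)) = 0.
  apply: mean_derive; first exact: cperiodicM.
    by move=> x; have ? := dP x; exact: ex_derive.
  by rewrite DE; exact: t3.2.
rewrite DE meanD// ?meanZ//; last exact: cperiodicZ.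
by move/eqP; rewrite addr_eq0 => /eqP ->; rewrite mulNr.
Qed.

Lemma mean_parts_cos u m i : cperiodic u ->
  (forall x, derivable u x (delta_mx 0 i)) -> continuous ('D_(delta_mx 0 i) u) ->
  mean (fun x => 'D_(delta_mx 0 i) u x * cosw m x) =
  freq m 0 i * mean (fun x => u x * sinw m x).
Proof.
move=> tu du cD.
have tN : cperiodic (fun y => - sin (dotv y (freq m))) by apply: cperiodicN; exact: cperiodic_sinw.
rewrite (@mean_parts u cos (fun t => - sin t) m i tu du cD (cperiodic_cosw m) tN).
  rewrite (_ : (fun x => u x * - _) = fun x => -1 * (u x * sinw m x)).
    by rewrite meanZ; [ring|apply: cperiodicM => //; exact: cperiodic_sinw].
  by apply/funext => x; rewrite mulN1r mulrN.
Qed.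

Lemma mean_parts_sin u m i : cperiodic u ->
  (forall x, derivable u x (delta_mx 0 i)) -> continuous ('D_(delta_mx 0 i) u) ->
  mean (fun x => 'D_(delta_mx 0 i) u x * sinw m x) =
  - freq m 0 i * mean (fun x => u x * cosw m x).
Proof.
move=> tu du cD.
by rewrite (@mean_parts u sin cos m i tu du cD (cperiodic_sinw m) (cperiodic_cosw m)).
Qed.

End waves.

(** * Uniqueness of Fourier coefficients *)

Section uniqueness.
Context {R : realType} {n : nat}.
Notation E := 'rV[R]_n.
Implicit Types (f g u : E -> R) (x y a v : E) (i : 'I_n) (m : 'rV[int]_n).

Definition fourier_null g :=
  forall m, mean (fun x => g x * cosw m x) = 0 /\ mean (fun x => g x * sinw m x) = 0.

Lemma cosw0 x : cosw 0 x = 1 :> R.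
Proof. by rewrite /cosw /freq map_mx0 scaler0 /dotv big1 ?cos0// => i _; rewrite mxE mulr0. Qed.

Lemma cosw_delta i x : cosw (delta_mx 0 i) x = cos (2 * pi * x 0 i).
Proof.
rewrite /cosw /freq (_ : map_mx _ _ = delta_mx 0 i).
  by rewrite dotvZr dotv_delta.
by apply/rowP => j; rewrite !mxE; case: (_ && _).
Qed.

Lemma mul_cosw m m' x : cosw m x * cosw m' x = 2^-1 * (cosw (m + m') x + cosw (m - m') x).
Proof. by rewrite !coswD coswN sinwN; field. Qed.

Lemma mul_sinw_cosw m m' x : sinw m x * cosw m' x = 2^-1 * (sinw (m + m') x + sinw (m - m') x).
Proof. by rewrite !sinwD coswN sinwN; field. Qed.

Lemma fourier_nullD f g : cperiodic f -> cperiodic g -> fourier_null f -> fourier_null g ->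
  fourier_null (fun x => f x + g x).
Proof.
move=> tf tg hf hg m; have [f1 f2] := hf m; have [g1 g2] := hg m.
have tc := @cperiodic_cosw R n m; have ts := @cperiodic_sinw R n m.
split; under eq_fun do rewrite mulrDl.
  by rewrite meanD ?f1 ?g1 ?addr0//; exact: cperiodicM.
by rewrite meanD ?f2 ?g2 ?addr0//; exact: cperiodicM.
Qed.

Lemma fourier_null0 : fourier_null (fun=> 0).
Proof. by move=> m; split; under eq_fun do rewrite mul0r; rewrite mean_cst. Qed.

Lemma fourier_null_sum (I : finType) (F : I -> E -> R) : (forall j, cperiodic (F j)) ->
  (forall j, fourier_null (F j)) -> fourier_null (fun x => \sum_j F j x).
Proof.
move=> tF hF; pose G (r : seq I) x := \sum_(j <- r) F j x.
suff : cperiodic (G (index_enum I)) /\ fourier_null (G (index_enum I)) by case.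
elim: (index_enum I) => [|j r [tG hG]].
  have -> : G [::] = fun=> 0 by apply/funext => x; rewrite /G big_nil.
  by split; [exact: cperiodic_cst|exact: fourier_null0].
have -> : G (j :: r) = fun x => F j x + G r x by apply/funext => x; rewrite /G big_cons.
by split; [exact: cperiodicD|exact: fourier_nullD].
Qed.

Lemma fourier_nullZ (c : R) f : cperiodic f -> fourier_null f -> fourier_null (fun x => c * f x).
Proof.
move=> tf hf m; have [f1 f2] := hf m.
have tc := @cperiodic_cosw R n m; have ts := @cperiodic_sinw R n m.
split; under eq_fun do rewrite -mulrA.
  by rewrite meanZ ?f1 ?mulr0//; exact: cperiodicM.
by rewrite meanZ ?f2 ?mulr0//; exact: cperiodicM.
Qed.

(** Multiplication by a wave shifts the frequencies. *)
Lemma fourier_null_cosw m f : cperiodic f -> fourier_null f -> fourier_null (fun x => f x * cosw m x).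
Proof.
move=> tf hf m'.
have tc k := @cperiodic_cosw R n k; have ts k := @cperiodic_sinw R n k.
split.
  rewrite (_ : (fun _ => _) = fun x => 2^-1 * (f x * cosw (m' + m) x + f x * cosw (m' - m) x)).
    rewrite meanZ ?meanD ?(hf _).1 ?addr0 ?mulr0//; try exact: cperiodicM.
    by apply: cperiodicD; exact: cperiodicM.
  by apply/funext => x; rewrite -mulrA (mulrC (cosw m x)) mul_cosw; ring.
rewrite (_ : (fun _ => _) = fun x => 2^-1 * (f x * sinw (m' + m) x + f x * sinw (m' - m) x)).
  rewrite meanZ ?meanD ?(hf _).2 ?addr0 ?mulr0//; try exact: cperiodicM.
  by apply: cperiodicD; exact: cperiodicM.
by apply/funext => x; rewrite -mulrA (mulrC (cosw m x)) mul_sinw_cosw; ring.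
Qed.

(** By the addition formulas, a translation mixes the two coefficients of a
    given frequency. *)
Lemma fourier_null_shift f a : cperiodic f -> fourier_null f -> fourier_null (fun x => f (x + a)).
Proof.
move=> tf hf m; have [f1 f2] := hf m.
have tc := @cperiodic_cosw R n m; have ts := @cperiodic_sinw R n m.
have t1 := cperiodicM tf tc; have t2 := cperiodicM tf ts.
split.
  rewrite -(mean_shift (- a)); last by apply: cperiodicM => //; exact: cperiodic_shift.
  rewrite (_ : (fun _ => _) = fun x => cosw m a * (f x * cosw m x) + sinw m a * (f x * sinw m x)).
    by rewrite meanD ?meanZ ?f1 ?f2 ?mulr0 ?addr0//; exact: cperiodicZ.
  apply/funext => x; rewrite addrNK /cosw /sinw dotvBl cosB; ring.
rewrite -(mean_shift (- a)); last by apply: cperiodicM => //; exact: cperiodic_shift.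
rewrite (_ : (fun _ => _) = fun x => cosw m a * (f x * sinw m x) + - sinw m a * (f x * cosw m x)).
  by rewrite meanD ?meanZ ?f1 ?f2 ?mulr0 ?addr0//; exact: cperiodicZ.
apply/funext => x; rewrite addrNK /cosw /sinw dotvBl sinB; ring.
Qed.

Definition bump y : R := (2 * n.+1%:R)^-1 * \sum_i (1 - cosw (delta_mx 0 i) y).

Lemma cperiodic_bump : cperiodic bump.
Proof.
apply: cperiodicZ; apply: cperiodic_sum => i; apply: cperiodicD; first exact: cperiodic_cst.
exact/cperiodicN/cperiodic_cosw.
Qed.

Lemma bump_le1 y : bump y <= 1.
Proof.
rewrite /bump ler_pdivrMl ?mulr_gt0// mulr1.
apply: (@le_trans _ _ (\sum_(i < n) 2)).
  by apply: ler_sum => i _; have := @cos_geN1 R (dotv y (freq (delta_mx 0 i))); rewrite /cosw; lra.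
by rewrite sumr_const card_ord -[leLHS]mulr_natr ler_wpM2l// ler_nat.
Qed.

Lemma bump0 : bump 0 = 0.
Proof.
rewrite /bump big1 ?mulr0// => i _.
by rewrite cosw_delta mxE mulr0 cos0 subrr.
Qed.

Lemma two_pi_itv (t : R) : 0 <= t <= 2^-1 -> 0 <= 2 * pi * t <= pi.
Proof.
move=> /andP[t0 t1]; have p0 := @pi_ge0 R.
rewrite (_ : 2 * pi * t = pi * (2 * t)); last by ring.
rewrite mulr_ge0 ?mulr_ge0//= ler_piMr//; lra.
Qed.

(** The bump function vanishes on the integer lattice only, so that it separates the
    points of the lattice from those away from it. *)
Lemma bump_small (del : R) : 0 < del -> exists2 eta : R, 0 < eta <= 2^-1 &
  forall y, bump y < 2 * eta -> exists m, `|y - map_mx intr m| <= del.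
Proof.
move=> del0; pose d1 := Num.min del 2^-1.
have d10 : 0 < d1 by rewrite lt_min del0 invr_gt0 ltr0n.
have d1del : d1 <= del by rewrite ge_min lexx.
have d12 : d1 <= 2^-1 by rewrite ge_min lexx orbT.
have pi0 := @pi_gt0 R.
pose kap := 1 - cos (2 * pi * d1).
have kap0 : 0 < kap.
  rewrite subr_gt0 -[ltRHS]cos0 ltr_cos ?in_itv/= ?lexx ?pi_ge0 ?mulr_gt0//.
  by apply: two_pi_itv; rewrite d12 ltW.
have kap2 : kap <= 2 by have := cos_geN1 (2 * pi * d1); rewrite /kap; lra.
exists (kap / (4 * n.+1%:R)).
  rewrite divr_gt0 ?mulr_gt0//= ler_pdivrMr ?mulr_gt0//.
  apply: le_trans kap2 _; rewrite mulrA -[4]/(4%:R) (_ : 2^-1 * 4 = 2); last by field.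
  by rewrite ler_peMr// ler1n.
move=> y yb; (* The integer vector nearest to [y]. *)
pose hv : E := \row_i 2^-1; pose m := int_part (y + hv).
exists m; apply: row_norm_le => [|i]; first exact: ltW.
have /andP[r0 r1] := frac_part (y + hv) i.
set r := (y - map_mx intr m) 0 i.
have rE : (y + hv - map_mx intr (int_part (y + hv))) 0 i = r + 2^-1.
  by rewrite /r /m !mxE; ring.
rewrite rE in r0 r1.
have r12 : `|r| <= 2^-1 by rewrite ler_norml; apply/andP; split; lra.
rewrite leNgt; apply/negP => delr.
have : kap <= 1 - cosw (delta_mx 0 i) y.
  have -> : cosw (delta_mx 0 i) y = cos (2 * pi * `|r|).
    transitivity (cosw (delta_mx 0 i) (y - map_mx intr m)).
      rewrite -map_mxN (zperiodic_int _ _ (@cperiodic_cosw R n _).1)//.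
    rewrite cosw_delta -/r; case: (ger0P r) => // _.
    by rewrite mulrN cosN.
  rewrite lerD2l lerN2 le_eqVlt; apply/orP; right.
  rewrite ltr_cos ?in_itv/=.
  - by rewrite ltr_pM2l ?mulr_gt0// (le_lt_trans d1del).
  - by apply: two_pi_itv; rewrite d12 ltW.
  - by apply: two_pi_itv; rewrite normr_ge0.
apply/negP; rewrite -ltNge.
have : 1 - cosw (delta_mx 0 i) y <= 2 * n.+1%:R * bump y.
  rewrite /bump mulVKf ?mulf_neq0 ?pnatr_eq0//.
  rewrite (bigD1 i)//= lerDl sumr_ge0// => j _.
  by rewrite subr_ge0 cos_le1.
move/le_lt_trans; apply.
have N0 : 0 < n.+1%:R :> R by [].
apply: lt_le_trans (_ : 2 * n.+1%:R * (2 * (kap / (4 * n.+1%:R))) <= _).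
  by rewrite ltr_pM2l ?mulr_gt0.
rewrite le_eqVlt; apply/orP; left; apply/eqP; field.
by rewrite gt_eqF.
Qed.

(** The powers of [1 + eta - bump] are trigonometric polynomials that concentrate
    near the lattice: they are bounded by [(1 - eta) ^ N] away from it, while their means
    stay above a positive constant. *)
Lemma fourier_null_le0 g : cperiodic g -> fourier_null g -> g 0 <= 0.
Proof.
move=> tg hg; rewrite leNgt; apply/negP => g0.
pose c := g 0 / 2; have c0 : 0 < c by rewrite divr_gt0.
have [del del0 ug] := cperiodic_ucont tg c0.
have [eta /andP[eta0 eta2] Heta] := bump_small del0.
have [B B0 gB] := cperiodic_bounded tg.
pose Q y := 1 + eta - bump y.
have Q0 y : 0 <= Q y by have := bump_le1 y; rewrite /Q; lra.
have tQ : cperiodic Q by apply: cperiodicD; [exact: cperiodic_cst|exact/cperiodicN/cperiodic_bump].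
have tQN N : cperiodic (fun y => Q y ^+ N) by exact: cperiodicX.
have eta1 : 0 <= 1 - eta by lra.
have near_c y : bump y < 2 * eta -> c <= g y.
  move=> /Heta[m ym].
  have := ug (y - map_mx intr m) 0; rewrite subr0 => /(_ ym).
  rewrite -map_mxN (zperiodic_int _ _ tg.1) ler_norml /c => /andP[+ _]; lra.
have hN N : fourier_null (fun y => g y * Q y ^+ N).
  elim: N => [|N IH]; first by under eq_fun do rewrite expr0 mulr1.
  pose G y := g y * Q y ^+ N; have tG : cperiodic G by exact: cperiodicM.
  pose b0 : R := (2 * n.+1%:R)^-1.
  have -> : (fun y => g y * Q y ^+ N.+1) = fun y => (1 + eta - b0 * n%:R) * G y +
      \sum_i b0 * (G y * cosw (delta_mx 0 i) y).
    apply/funext => y; rewrite -!mulr_sumr exprS /G /Q /bump -/b0 sumrB.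
    rewrite sumr_const card_ord; ring.
  have tGc i : cperiodic (fun y => G y * cosw (delta_mx 0 i) y).
    by apply: cperiodicM => //; exact: cperiodic_cosw.
  apply: fourier_nullD; [exact: cperiodicZ| |exact: fourier_nullZ|].
    by apply: cperiodic_sum => i; exact: cperiodicZ.
  apply: fourier_null_sum => i; first exact: cperiodicZ.
  by apply: fourier_nullZ => //; exact: fourier_null_cosw.
have tgQ N : cperiodic (fun y => g y * Q y ^+ N) by exact: cperiodicM.
have mean0 N : mean (fun y => g y * Q y ^+ N) = 0.
  have [+ _] := hN N 0; congr (_ = _); congr mean.
  by apply/funext => y; rewrite cosw0 mulr1.
have upper N : c * mean (fun y => Q y ^+ N) <= (B + c) * (1 - eta) ^+ N.
  rewrite -meanZ// -(@mean_cst R n ((B + c) * (1 - eta) ^+ N)) -[leRHS]addr0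
    -[X in _ <= _ + X](mean0 N).
  rewrite -meanD//; last exact: cperiodic_cst.
  apply: mean_le => [||y]; [exact: cperiodicZ|by apply: cperiodicD => //; exact: cperiodic_cst|].
  have QN0 : 0 <= Q y ^+ N by exact: exprn_ge0.
  have [by1|by2] := ltP (bump y) (2 * eta).
    apply: (@le_trans _ _ (g y * Q y ^+ N)).
      by rewrite ler_wpM2r// near_c.
    rewrite lerDr; apply: mulr_ge0; last exact: exprn_ge0.
    by apply: addr_ge0 => //; exact: ltW.
  have QN1 : Q y ^+ N <= (1 - eta) ^+ N.
    by apply: lerXn2r; rewrite ?nnegrE//; rewrite /Q; lra.
  have h1 : (B + c) * Q y ^+ N <= (B + c) * (1 - eta) ^+ N.
    by rewrite ler_wpM2l// addr_ge0// ltW.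
  have h2 : - B * Q y ^+ N <= g y * Q y ^+ N.
    by rewrite ler_wpM2r//; have := gB y; rewrite ler_norml => /andP[].
  lra.
(* The translates of the neighbourhood [Q >= 1] of the lattice by a fine grid
   cover the torus. *)
have [M Mlow] : exists M : nat, forall N,
    1 <= #|{: 'rV['I_M.+1]_n}|%:R * mean (fun y => Q y ^+ N).
  have [d2 d20 ub] := cperiodic_ucont cperiodic_bump eta0.
  exists (Num.trunc d2^-1) => N; set M := Num.trunc _.
  have Md : M.+1%:R^-1 <= d2.
    rewrite -[leRHS]invrK lef_pV2 ?posrE ?invr_gt0//.
    exact/ltW/truncnS_gt.
  have -> : #|{: 'rV['I_M.+1]_n}|%:R * mean (fun y => Q y ^+ N) =
      mean (fun x => \sum_k Q (x + @grid_point R n M k) ^+ N).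
    rewrite mean_sum => [|k]; last exact: (cperiodic_shift _ (tQN N)).
    rewrite (eq_bigr (fun=> mean (fun y => Q y ^+ N))).
      by rewrite sumr_const mulr_natl.
    by move=> k _; rewrite (mean_shift _ (tQN N)).
  rewrite -[leLHS](@mean_cst R n); apply: mean_le => [||x]; first exact: cperiodic_cst.
    by apply: cperiodic_sum => k; exact: (cperiodic_shift _ (tQN N)).
  have [m [j [r [xE rM]]]] := grid_decomp M (- x).
  rewrite (bigD1 j)//= -[leLHS]addr0; apply: lerD.
    rewrite exprn_ege1// /Q.
    suff : bump (x + grid_point j) <= eta by lra.
    have -> : x + grid_point j = - r + map_mx intr (- m).
      have -> : x = - (r + grid_point j + map_mx intr m) by rewrite -xE opprK.
      by rewrite map_mxN !opprD addrAC subrK.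
    rewrite zperiodic_int; last exact: cperiodic_bump.1.
    have := ub (- r) 0; rewrite subr0 normrN bump0 subr0 => /(_ (le_trans rM Md)).
    exact: le_trans (ler_norm _).
  by apply: sumr_ge0 => k _; exact: exprn_ge0.
pose K : R := #|{: 'rV['I_M.+1]_n}|%:R.
have cK N : c <= K * (B + c) * (1 - eta) ^+ N.
  rewrite -mulrA; apply: le_trans (ler_wpM2l _ (upper N)); last by [].
  by rewrite mulrCA -[leLHS]mulr1 ler_wpM2l// ?(ltW c0).
have lim0 : K * (B + c) * (1 - eta) ^+ N @[N --> \oo] --> 0.
  rewrite -[X in _ --> X](mulr0 (K * (B + c))); apply: cvgM; first exact: cvg_cst.
  by apply: cvg_expr; rewrite ger0_norm; lra.
have : c <= 0 by apply: (cvgr_to_ge lim0); exact: nearW.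
by rewrite leNgt c0.
Qed.

(** A translation brings [x] to the origin, and a change of sign gives the other
    inequality. *)
Theorem fourier_null_eq0 g : cperiodic g -> fourier_null g -> forall x, g x = 0.
Proof.
move=> tg hg x; apply/eqP; rewrite eq_le; apply/andP; split.
  have := fourier_null_le0 (cperiodic_shift x tg) (fourier_null_shift x tg hg).
  by rewrite add0r.
have tN := cperiodicZ (-1) tg; have hN := fourier_nullZ (-1) tg hg.
have := fourier_null_le0 (cperiodic_shift x tN) (fourier_null_shift x tN hN).
by rewrite add0r mulN1r oppr_le0.
Qed.

End uniqueness.

(** * Fourier coefficients of spherical means *)

Section exchange.
Context {R : realType} (d : nat) (s : R).
Hypothesis s_gt0 : 0 < s.
Notation E := 'rV[R]_d.+1.
Notation sint := (@sphere_integral R d s).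
Implicit Types (u v w : E -> R) (x y a : E) (i : 'I_d.+1) (m : 'rV[int]_d.+1).

Lemma continuous_modulus v : (forall e : R, 0 < e -> exists2 del : R, 0 < del &
    forall x y, `|x - y| <= del -> `|v x - v y| <= e) -> continuous v.
Proof.
move=> h x; apply/(@cvgrPdist_le _ _ _ (nbhs x) (nbhs_filter x)) => /= e e0.
have [del d0 vd] := h e e0.
apply/nbhs_ballP; exists del => //= y; rewrite mx_norm_ball /ball_/= => xy.
exact/vd/ltW.
Qed.

Definition sphere_mean v i x : R := sint (fun y => y 0 i * v (x + y)).

Let ci i : continuous (fun y : E => y 0 i).
Proof. exact: coord_continuous. Qed.

Let cv v i x : continuous v -> continuous (fun y => y 0 i * v (x + y)).
Proof.
move=> cv y; have h : continuous_at y (fun y => v (x + y)).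
  apply: (@continuous_comp _ _ _ (fun z : E => x + z) v); last exact: cv.
  exact: cvgD (cvg_cst _) (@cvg_id _ _).
exact: cvgM (@ci i y) h.
Qed.

Lemma sphere_mean_dist v i (del e : R) x x' : continuous v ->
  (forall x y, `|x - y| <= del -> `|v x - v y| <= e) -> `|x - x'| <= del ->
  `|sphere_mean v i x - sphere_mean v i x'| <= s * e * sint (fun=> 1).
Proof.
move=> cvv uv xx'; have cm z : continuous (fun y => -1 * (y 0 i * v (z + y))).
  by move=> y; exact: cvgM (cvg_cst _) (@cv v i z cvv y).
rewrite /sphere_mean -mulN1r -(sintZ s_gt0 _ (@cv v i x' cvv)).
rewrite -(sintD s_gt0 (@cv v i x cvv) (cm x')).
apply: (sint_le_norm s_gt0) => [y|y Sy].
  exact: cvgD (@cv v i x cvv y) (cm x' y).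
rewrite mulN1r -mulrBr normrM ler_pM ?(sphere_coord i Sy)// uv//.
by rewrite opprD addrACA subrr addr0.
Qed.

Lemma cperiodic_sphere_mean v i : cperiodic v -> cperiodic (sphere_mean v i).
Proof.
move=> tv; split=> [x j|].
  by apply: eq_sint => y _; rewrite addrAC tv.1.
have m0 := sint1_gt0 d s_gt0.
apply: continuous_modulus => e e0.
have e'0 : 0 < e / (s * sint (fun=> 1)) by rewrite divr_gt0// mulr_gt0.
have [del d0 uv] := cperiodic_ucont tv e'0; exists del => // x y xy.
apply: le_trans (sphere_mean_dist i tv.2 uv xy) _.
rewrite le_eqVlt; apply/orP; left; apply/eqP; field.
by rewrite !gt_eqF.
Qed.

Lemma mean_modulus v w (B e del : R) : cperiodic v -> cperiodic w ->
  (forall x, `|v x| <= B) -> (forall x, `|w x| <= B) ->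
  (forall x y, `|x - y| <= del -> `|v x - v y| <= e) ->
  (forall x y, `|x - y| <= del -> `|w x - w y| <= e) ->
  forall a x y, `|x - y| <= del ->
    `|w x * v (x + a) - w y * v (y + a)| <= B * e + B * e.
Proof.
move=> tv tw vB wB uv uw a x y xy.
have -> : w x * v (x + a) - w y * v (y + a) =
  w x * (v (x + a) - v (y + a)) + (w x - w y) * v (y + a) by ring.
apply: le_trans (ler_normD _ _) _; rewrite !normrM; apply: lerD.
  by apply: ler_pM => //; apply: uv; rewrite opprD addrACA subrr addr0.
by rewrite mulrC; apply: ler_pM => //; exact: uw.
Qed.

(** Fubini: a grid mean is a finite sum, and the grid means converge to the mean
    uniformly in the translation. *)
Lemma mean_sphere_mean v w i : cperiodic v -> cperiodic w ->
  mean (fun x => w x * sphere_mean v i x) =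
  sint (fun y => y 0 i * mean (fun x => w x * v (x + y))).
Proof.
move=> tv tw; set D := sint _.
have m0 := sint1_gt0 d s_gt0.
have [B1 B10 vB1] := cperiodic_bounded tv; have [B2 B20 wB2] := cperiodic_bounded tw.
pose B := B1 + B2 + 1.
have B0 : 0 < B by rewrite /B; lra.
have vB x : `|v x| <= B by apply: le_trans (vB1 x) _; rewrite /B; lra.
have wB x : `|w x| <= B by apply: le_trans (wB2 x) _; rewrite /B; lra.
have tvw y : cperiodic (fun x => w x * v (x + y)) by apply: cperiodicM => //; exact: cperiodic_shift.
pose H y := mean (fun x => w x * v (x + y)).
have cH : continuous H.
  apply: continuous_modulus => e e0.
  have e'0 : 0 < e / B by rewrite divr_gt0.
  have [del d0 uv] := cperiodic_ucont tv e'0; exists del => // y y' yy'.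
  rewrite /H -meanB//; apply: mean_norm => [|x].
    by apply: cperiodicD => //; exact: cperiodicN.
  rewrite -mulrBr normrM -[leRHS](divfK (lt0r_neq0 B0)) mulrC.
  apply: ler_pM => //; apply: uv.
  by rewrite opprD addrACA subrr add0r.
have cyH : continuous (fun y => y 0 i * H y).
  by move=> y; exact: cvgM (@ci i y) (cH y).
pose P N y := grid_mean N (fun x => w x * (y 0 i * v (x + y))).
have cK N k : continuous (fun y : E =>
    w (@grid_point R d.+1 N k) * (y 0 i * v (grid_point k + y))).
  by move=> y; exact: cvgM (cvg_cst _) (@cv v i (grid_point k) tv.2 y).
have cS N : continuous (fun y : E => \sum_(k : 'rV['I_N.+1]_d.+1)
    w (grid_point k) * (y 0 i * v (grid_point k + y))).
  by apply: continuous_sum => k _; exact: cK.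
have cP N : continuous (P N) by move=> y; exact: cvgM (cvg_cst _) (cS N y).
have PE N : grid_mean N (fun x => w x * sphere_mean v i x) = sint (P N).
  rewrite /P /grid_mean (sintZ s_gt0 _ (cS N)).
  congr (_ * _); rewrite (sint_sum s_gt0 xpredT (cK N)).
  by apply: eq_bigr => k _; rewrite (sintZ s_gt0)//; exact: cv tv.2.
have tG := cperiodic_sphere_mean i tv.
have cvgG := grid_mean_cvg (cperiodicM tw tG).
apply/eqP; rewrite -subr_eq0 -normr_le0; apply/ler_addgt0Pl => e e0; rewrite addr0.
have e'0 : 0 < e / (4 * B * s * sint (fun=> 1)) by rewrite divr_gt0 ?mulr_gt0.
have [d1 d10 uv] := cperiodic_ucont tv e'0; have [d2 d20 uw] := cperiodic_ucont tw e'0.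
have h : (fun N => grid_mean N (fun x => w x * sphere_mean v i x) - D) @ \oo -->
    mean (fun x => w x * sphere_mean v i x) - D.
  by apply: cvgB; [exact: cvgG|exact: cvg_cst].
apply: (cvgr_to_le (cvg_norm h)).
have dm0 : 0 < Num.min d1 d2 by rewrite lt_min d10.
have uv' x y : `|x - y| <= Num.min d1 d2 ->
    `|v x - v y| <= e / (4 * B * s * sint (fun=> 1)).
  by rewrite le_min => /andP[xy _]; exact: uv.
have uw' x y : `|x - y| <= Num.min d1 d2 ->
    `|w x - w y| <= e / (4 * B * s * sint (fun=> 1)).
  by rewrite le_min => /andP[_ xy]; exact: uw.
have := near_infty_natSinv_lt (PosNum dm0); apply: filterS => N /= /ltW Nd.
have cmH : continuous (fun y => -1 * (y 0 i * H y)).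
  by move=> y; exact: cvgM (cvg_cst _) (cyH y).
rewrite PE -mulN1r /D -(sintZ s_gt0 _ cyH) -(sintD s_gt0 (cP N) cmH).
apply: le_trans (@sint_le_norm R d s s_gt0 _ (s * (2 * (2 * B * (e / (4 * B * s * sint (fun=> 1)))))) _ _) _.
- by move=> y; exact: cvgD (cP N y) (cmH y).
- move=> y Sy; rewrite mulN1r.
  have -> : P N y = y 0 i * grid_mean N (fun x => w x * v (x + y)).
    by rewrite -grid_meanZ; congr grid_mean; apply/funext => x; ring.
  rewrite -mulrBr normrM ler_pM ?(sphere_coord i Sy)// distrC.
  apply: (mean_approx (tvw y) _ Nd) => x x' xx'.
  rewrite [leRHS](_ : _ = B * (e / (4 * B * s * sint (fun=> 1))) +
      B * (e / (4 * B * s * sint (fun=> 1)))); last by ring.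
  apply: (mean_modulus tv tw vB wB uv' uw' _ xx').
rewrite le_eqVlt; apply/orP; left; apply/eqP; field.
by rewrite !gt_eqF.
Qed.

End exchange.

Section scalar_equivalence.
Context {R : realType} (d : nat) (s : R).
Hypothesis s_gt0 : 0 < s.
Notation E := 'rV[R]_d.+1.
Notation sint := (@sphere_integral R d s).
Notation sphere_mean := (@sphere_mean R d s).
Implicit Types (v w : E -> R) (x y a : E) (i : 'I_d.+1) (m : 'rV[int]_d.+1).

Let ci i : continuous (fun y : E => y 0 i).
Proof. exact: coord_continuous. Qed.

Let continuous_cos_term m i (a : R) : continuous (fun y : E => y 0 i * cosw m y * a).
Proof. by move=> y; exact: cvgM (cvgM (@ci i y) ((@cperiodic_cosw R _ m).2 y)) (cvg_cst _). Qed.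

Let continuous_sin_term m i (a : R) : continuous (fun y : E => y 0 i * sinw m y * a).
Proof. by move=> y; exact: cvgM (cvgM (@ci i y) ((@cperiodic_sinw R _ m).2 y)) (cvg_cst _). Qed.

Lemma sint_waves m i (c a b : R) :
  (forall i, sint (fun y => y 0 i * sin (dotv y (freq m))) = freq m 0 i * c) ->
  sint (fun y => y 0 i * (cosw m y * a + sinw m y * b)) = freq m 0 i * c * b.
Proof.
move=> hc.
rewrite (@eq_sint _ _ _ _ (fun y => y 0 i * cosw m y * a + y 0 i * sinw m y * b)); last first.
  by move=> y _; ring.
rewrite (sintD s_gt0 (@continuous_cos_term m i a) (@continuous_sin_term m i b)).
have cc := @continuous_cos_term m i 1; have cs := @continuous_sin_term m i 1.
rewrite (@eq_sint _ _ _ _ (fun y => a * (y 0 i * cosw m y * 1))); last by move=> y _; ring.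
rewrite (sintZ s_gt0 _ cc).
rewrite [X in _ + X](@eq_sint _ _ _ _ (fun y => b * (y 0 i * sinw m y * 1))); last by move=> y _; ring.
rewrite (sintZ s_gt0 _ cs).
have -> : sint (fun y => y 0 i * cosw m y * 1) = 0.
  rewrite -(sint_coord_cos s_gt0 (freq m) i).
  by apply: eq_sint => y _; rewrite mulr1.
have -> : sint (fun y => y 0 i * sinw m y * 1) = freq m 0 i * c.
  by rewrite -hc; apply: eq_sint => y _; rewrite mulr1.
ring.
Qed.

Lemma mean_translate v w a : cperiodic v -> cperiodic w ->
  mean (fun x => w x * v (x + a)) = mean (fun x => w (x - a) * v x).
Proof.
move=> tv tw; rewrite -[RHS](mean_shift a).
  by congr mean; apply/funext => x; rewrite addrK.
by apply: cperiodicM => //; exact: cperiodic_shift.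
Qed.

Lemma mean_cosw_sphere_mean v i m (c : R) : cperiodic v ->
  (forall i, sint (fun y => y 0 i * sin (dotv y (freq m))) = freq m 0 i * c) ->
  mean (fun x => cosw m x * sphere_mean v i x) =
  c * (freq m 0 i * mean (fun x => v x * sinw m x)).
Proof.
move=> tv hc; have tc := @cperiodic_cosw R d.+1 m; have ts := @cperiodic_sinw R d.+1 m.
rewrite (mean_sphere_mean s_gt0 i tv tc).
rewrite (@eq_sint _ _ _ _ (fun y => y 0 i * (cosw m y * mean (fun x => v x * cosw m x) +
    sinw m y * mean (fun x => v x * sinw m x)))); last first.
  move=> y _; congr (_ * _); rewrite mean_translate//.
  have t1 := cperiodicM tv tc; have t2 := cperiodicM tv ts.
  rewrite -!meanZ// -meanD//; try exact: cperiodicZ.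
  congr mean; apply/funext => x; rewrite /cosw /sinw dotvBl cosB; ring.
by rewrite (sint_waves _ _ _ hc); ring.
Qed.

Lemma mean_sinw_sphere_mean v i m (c : R) : cperiodic v ->
  (forall i, sint (fun y => y 0 i * sin (dotv y (freq m))) = freq m 0 i * c) ->
  mean (fun x => sinw m x * sphere_mean v i x) =
  c * (- freq m 0 i * mean (fun x => v x * cosw m x)).
Proof.
move=> tv hc; have tc := @cperiodic_cosw R d.+1 m; have ts := @cperiodic_sinw R d.+1 m.
rewrite (mean_sphere_mean s_gt0 i tv ts).
rewrite (@eq_sint _ _ _ _ (fun y => y 0 i * (cosw m y * mean (fun x => v x * sinw m x) +
    sinw m y * (-1 * mean (fun x => v x * cosw m x))))); last first.
  move=> y _; congr (_ * _); rewrite mean_translate//.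
  have t1 := cperiodicM tv tc; have t2 := cperiodicM tv ts.
  rewrite -!meanZ -?meanD; try by do ?apply: cperiodicZ.
  congr mean; apply/funext => x; rewrite /cosw /sinw dotvBl sinB; ring.
by rewrite (sint_waves _ _ _ hc); ring.
Qed.

Variable u : 'I_d.+1 -> E -> R.
Hypothesis tu : forall i, cperiodic (u i).
Hypothesis du : forall i x, derivable (u i) x (delta_mx 0 i).
Hypothesis cDu : forall i, continuous ('D_(delta_mx 0 i) (u i)).

Definition divergence x : R := \sum_i 'D_(delta_mx 0 i) (u i) x.
Definition sphere_flux x : R := \sum_i sphere_mean (u i) i x.

Let cperiodicDu i : cperiodic ('D_(delta_mx 0 i) (u i)).
Proof. exact: cperiodic_derive. Qed.

Lemma cperiodic_divergence : cperiodic divergence.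
Proof. by apply: cperiodic_sum => i; exact: cperiodicDu. Qed.

Lemma cperiodic_sphere_flux : cperiodic sphere_flux.
Proof. by apply: cperiodic_sum => i; exact: cperiodic_sphere_mean. Qed.

Let mean_mul_sum (F : 'I_d.+1 -> E -> R) w : (forall i, cperiodic (F i)) -> cperiodic w ->
  mean (fun x => (\sum_i F i x) * w x) = \sum_i mean (fun x => F i x * w x).
Proof.
move=> tF tw; under eq_fun do rewrite mulr_suml.
by rewrite mean_sum// => i; exact: cperiodicM.
Qed.

(** By the divergence theorem, the flux is the convolution of the divergence with
    a multiple of the indicator function of a ball, hence it acts on Fourier
    coefficients by a multiplier; the proof computes both sides. *)
Lemma fourier_sphere_flux m (c : R) :
  (forall i, sint (fun y => y 0 i * sin (dotv y (freq m))) = freq m 0 i * c) ->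
  mean (fun x => sphere_flux x * cosw m x) = c * mean (fun x => divergence x * cosw m x) /\
  mean (fun x => sphere_flux x * sinw m x) = c * mean (fun x => divergence x * sinw m x).
Proof.
move=> hc; have tc := @cperiodic_cosw R d.+1 m; have ts := @cperiodic_sinw R d.+1 m.
have tG i := cperiodic_sphere_mean s_gt0 i (tu i).
rewrite !mean_mul_sum// !mulr_sumr; split; apply: eq_bigr => i _.
  rewrite mean_parts_cos// -mean_cosw_sphere_mean//.
  by congr mean; apply/funext => x; rewrite mulrC.
rewrite mean_parts_sin// -mean_sinw_sphere_mean//.
by congr mean; apply/funext => x; rewrite mulrC.
Qed.

(** At a frequency where the symbol kills [u], the divergence has no Fourier
    coefficient, whatever the value of the multiplier is. *)
Lemma mean_divergence_freq m : (forall x, \sum_i freq m 0 i * u i x = 0) ->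
  mean (fun x => divergence x * cosw m x) = 0 /\
  mean (fun x => divergence x * sinw m x) = 0.
Proof.
move=> hm; have tc := @cperiodic_cosw R d.+1 m; have ts := @cperiodic_sinw R d.+1 m.
have zero w : cperiodic w -> \sum_i freq m 0 i * mean (fun x => u i x * w x) = 0.
  move=> tw; under eq_bigr => i _ do rewrite -(meanZ _ (cperiodicM (tu i) tw)).
  rewrite -mean_sum => [|i]; last exact/cperiodicZ/cperiodicM.
  rewrite -[RHS](@mean_cst R d.+1 0); congr mean; apply/funext => x.
  transitivity ((\sum_i freq m 0 i * u i x) * w x); last by rewrite hm mul0r.
  by rewrite mulr_suml; apply: eq_bigr => i _; rewrite mulrA.
rewrite !mean_mul_sum//; split.
  by under eq_bigr => i _ do rewrite mean_parts_cos//; exact: zero.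
under eq_bigr => i _ do rewrite mean_parts_sin// mulNr.
by rewrite sumrN zero ?oppr0.
Qed.

(** The multiplier sends zero coefficients to zero coefficients, and it can be
    divided by at the frequencies at which the divergence may have a nonzero
    coefficient. *)
Theorem divergence_sphere_flux :
  (forall m, (forall x, \sum_i freq m 0 i * u i x = 0) \/
     besselJ (d.+1%:R / 2) (s * enorm (freq m)) != 0 :> R) ->
  (forall x, divergence x = 0) <-> (forall x, sphere_flux x = 0).
Proof.
move=> hJ; split=> h0; apply: fourier_null_eq0.
- exact: cperiodic_sphere_flux.
- move=> m; have [c [hc _]] := sint_coord_sin s_gt0 (freq m).
  have [-> ->] := fourier_sphere_flux hc.
  by split; under eq_fun do rewrite h0 mul0r; rewrite mean_cst mulr0.
- exact: cperiodic_divergence.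
- move=> m; have [c [hc cJ]] := sint_coord_sin s_gt0 (freq m).
  have [|Jm] := hJ m; first exact: mean_divergence_freq.
  have [n0|f0] := eqVneq (enorm (freq m) : R) 0.
    have f0 := enorm_eq0 n0.
    apply: mean_divergence_freq => x; rewrite big1// => i _.
    by rewrite f0 mxE mul0r.
  have c0 : c != 0 by apply: cJ => //; rewrite lt_neqAle eq_sym f0 enorm_ge0.
  have [e1 e2] := fourier_sphere_flux hc.
  split; apply: (mulfI c0); rewrite mulr0 -?e1 -?e2;
    by under eq_fun do rewrite h0 mul0r; rewrite mean_cst.
Qed.

End scalar_equivalence.

(** * Linear functionals on inner product spaces *)

Section linear_functionals.
Context {R : realType} {V : innerProductType R}.
Notation ip := (@inner R V).

Lemma innerC (a v : V) : ip a v = ip v a.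
Proof. by rewrite hermC expr0 mul1r. Qed.

(** Polarization makes inner products continuous because the norm is. *)
Lemma polarization (a v : V) : ip a v = 2^-1 * (`|a + v| ^+ 2 - `|a| ^+ 2 - `|v| ^+ 2).
Proof.
by rewrite !sqr_norm_inner linearDl !linearDr /= (innerC v a); field.
Qed.

Lemma continuous_inner (a : V) : continuous (ip a).
Proof.
rewrite (_ : ip a = fun v => 2^-1 * (`|a + v| ^+ 2 - `|a| ^+ 2 - `|v| ^+ 2)); last first.
  by apply/funext => v; exact: polarization.
have sq (f : V -> V) : continuous f -> continuous (fun v => `|f v| ^+ 2).
  move=> cf v; have h := @cvg_norm _ _ _ _ (nbhs_filter v) f (f v) (cf v).
  exact: (cvgM h h).
have h3 : continuous (fun v => a + v).
  by move=> x; exact: cvgD (cvg_cst _) (@cvg_id _ _).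
have h1 := sq _ h3; have h2 := sq id (fun x => cvg_id).
by move=> v; exact: cvgM (cvg_cst _) (cvgB (cvgB (h1 v) (cvg_cst _)) (h2 v)).
Qed.

Let e := vbasis {:V}.
Let N := \dim {:V}.

Let gram : 'M[R]_N := \matrix_(i, j) ip e`_i e`_j.

Lemma gram_unit : gram \in unitmx.
Proof.
rewrite -row_free_unit; apply/inj_row_free => c cG.
pose w := \sum_(i < N) c 0 i *: e`_i.
have we (j : 'I_N) : ip w e`_j = 0.
  have := congr1 (fun M : 'rV_N => M 0 j) cG; rewrite !mxE => <-.
  rewrite /w linear_sumlz; apply: eq_bigr => i _.
  by rewrite mxE linearZl_LR.
have w0 : w = 0.
  apply/eqP; rewrite -normr_eq0 -sqrf_eq0 sqr_norm_inner {2}/w linear_sumr.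
  by apply/eqP; rewrite big1// => j _; rewrite linearZr_LR /= we mulr0.
have /freeP/(_ (c 0) w0) h := basis_free (vbasisP {:V}).
by apply/rowP => i; rewrite mxE h.
Qed.

(** Coordinates are obtained from inner products by inverting the Gram matrix,
    which makes them, and so all linear functionals, continuous. *)
Lemma coord_inner (v : V) i : coord e i v = \sum_(j < N) ip v e`_j * invmx gram j i.
Proof.
have : (\row_i coord e i v) *m gram = \row_(j < N) ip v e`_j.
  apply/rowP => j; rewrite !mxE {2}(coord_vbasis (memvf v)) linear_sumlz.
  by apply: eq_bigr => k _; rewrite !mxE linearZl_LR.
move/(congr1 (mulmx^~ (invmx gram))); rewrite mulmxK ?gram_unit// => /rowP/(_ i).
by rewrite !mxE => ->; apply: eq_bigr => j _; rewrite mxE.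
Qed.

Lemma continuous_coord i : continuous (coord e i : V -> R).
Proof.
rewrite (_ : (coord e i : V -> R) = fun v => \sum_(j < N) ip e`_j v * invmx gram j i); last first.
  apply/funext => v; rewrite coord_inner; apply: eq_bigr => j _.
  by rewrite innerC.
apply: (@continuous_sum R V) => j _ v.
have h := @continuous_inner e`_j v.
exact: (cvgM h (cvg_cst (invmx gram j i))).
Qed.

Lemma continuous_functional (L : V -> R) : linear_for *%R L -> continuous L.
Proof.
move=> linL; pose LL : {linear V -> R | *%R} := HB.pack L (GRing.isLinear.Build R V R *%R L linL).
rewrite (_ : L = fun v => \sum_(i < N) coord e i v * L e`_i).
  apply: (@continuous_sum R V) => i _ v.
  have h := @continuous_coord i v.
  exact: (cvgM h (cvg_cst (L e`_i))).
apply/funext => v; rewrite {1}(coord_vbasis (memvf v)).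
rewrite -[L _]/(LL _) linear_sum; apply: eq_bigr => i _.
by rewrite linearZ.
Qed.

Lemma is_derive_functional n (L : V -> R) (u : 'rV[R]_n -> V) x v : linear_for *%R L ->
  derivable u x v -> is_derive x v (L \o u) (L ('D_v u x)).
Proof.
move=> linL du; pose LL : {linear V -> R | *%R} := HB.pack L (GRing.isLinear.Build R V R *%R L linL).
have cL := continuous_functional linL.
have h : (fun h : R => h^-1 *: ((L \o u) (h *: v + x) - (L \o u) x)) @ 0^' --> L ('D_v u x).
  rewrite (_ : (fun h : R => _) = L \o (fun h : R => h^-1 *: (u (h *: v + x) - u x))).
    apply: continuous_cvg; first exact: cL.
    exact: du.
  apply/funext => h /=.
  have -> (a b : V) : L (h^-1 *: (a - b)) = h^-1 * (L a - L b).
    by rewrite -[L]/(LL : V -> R) linearZ linearB.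
  by [].
split; first by apply/cvg_ex; exists (L ('D_v u x)).
exact/cvg_lim.
Qed.

End linear_functionals.

(** * Reduction of vector-valued maps to coordinates *)

Section vector_valued.
Context {R : realType} (d : nat) {V W : innerProductType R}.
Variables (A : 'I_d.+1 -> 'Hom(V, W)) (s : R).
Hypothesis s_gt0 : 0 < s.
Notation E := 'rV[R]_d.+1.
Notation e := (vbasis {:W}).
Implicit Types (x y : E) (u : E -> V) (i : 'I_d.+1) (j : 'I_(\dim {:W})) (m : 'rV[int]_d.+1).

Definition component j u i x : R := coord e j (A i (u x)).

Lemma linear_component j i : linear_for *%R (fun v : V => coord e j (A i v)).
Proof. by move=> a v w; rewrite !linearP. Qed.

Lemma coord_eq0 (w : W) : (forall j, coord e j w = 0) <-> w = 0.
Proof.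
split=> [h|-> j]; last by rewrite linear0.
by rewrite (coord_vbasis (memvf w)) big1// => j _; rewrite h scale0r.
Qed.

Lemma coord_symbol j (xi : E) (v : V) :
  coord e j (symbol A xi v) = \sum_i xi 0 i * coord e j (A i v).
Proof.
rewrite /symbol sum_lfunE linear_sum; apply: eq_bigr => i _.
by rewrite scale_lfunE linearZ.
Qed.

Variable u : E -> V.
Hypothesis su : smooth u.
Hypothesis pu : forall x i, u (x + delta_mx 0 i) = u x.

Lemma cperiodic_component j i : cperiodic (component j u i).
Proof.
split=> [x k|x]; first by rewrite /component pu.
have cL := continuous_functional (@linear_component j i).
exact: (@continuous_comp E V R u _ x ((su [::]).1 x) (cL _)).
Qed.

Lemma is_derive_component j i k x :
  is_derive x (delta_mx 0 k) (component j u i) (coord e j (A i (partial k u x))).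
Proof.
exact: (is_derive_functional (@linear_component j i) ((su [::]).2 k x)).
Qed.

Lemma derive_component j i k :
  'D_(delta_mx 0 k) (component j u i) = fun x => coord e j (A i (partial k u x)).
Proof. by apply/funext => x; have ? := is_derive_component j i k x; exact: derive_val. Qed.

Lemma continuous_derive_component j i :
  continuous ('D_(delta_mx 0 i) (component j u i)).
Proof.
rewrite derive_component => x.
have cL := continuous_functional (@linear_component j i).
exact: (@continuous_comp E V R (partial i u) _ x ((su [:: i]).1 x) (cL _)).
Qed.

Lemma diff_op_eq0 x :
  diff_op A u x = 0 <-> forall j, divergence (component j u) x = 0.
Proof.
have E1 j : divergence (component j u) x = coord e j (diff_op A u x).
  rewrite /diff_op linear_sum; apply: eq_bigr => i _.
  exact: (congr1 (@^~ x) (derive_component j i i)).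
rewrite -coord_eq0; split=> h j; have := h j; rewrite E1//.
Qed.

Lemma vintegral_eq0 (f : E -> W) :
  vintegral (@hausdorff R d.+1 d) (sphere s) f = 0 <->
  forall j, sphere_integral s (fun y => coord e j (f y)) = 0.
Proof.
split=> [h j|h]; last first.
  rewrite /vintegral big1// => j _; rewrite [X in X *: _](_ : _ = 0) ?scale0r//.
  exact: h.
by have /freeP/(_ (fun j => sphere_integral s (fun y => coord e j (f y))) h j) := basis_free (vbasisP {:W}).
Qed.

Lemma spherical_op_eq0 x :
  spherical_op A s u x = 0 <-> forall j, sphere_flux s (component j u) x = 0.
Proof.
have c0 : d.+1%:R * (fine (hausdorff d (sphere s : set E)))^-1 != 0.
  rewrite mulf_neq0 ?pnatr_eq0// invr_eq0 gt_eqF//.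
  by rewrite -(sint1 _ s_gt0); exact: sint1_gt0.
have -> : spherical_op A s u x = 0 <-> vintegral (@hausdorff R d.+1 d) (sphere s)
   (fun y => symbol A (s^-1 *: y) (s^-1 *: (u (x + y) - u x))) = 0.
  rewrite /spherical_op; split=> [/eqP|->]; last by rewrite scaler0.
  by rewrite scaler_eq0 (negbTE c0)/= => /eqP.
rewrite vintegral_eq0.
have ci i : continuous (fun y : E => y 0 i) by exact: coord_continuous.
suff E1 j : sphere_integral s (fun y => coord e j (symbol A (s^-1 *: y) (s^-1 *: (u (x + y) - u x)))) =
    s^-1 ^+ 2 * sphere_flux s (component j u) x.
  split=> h j; have := h j; rewrite E1; last by move=> ->; rewrite mulr0.
  by move/eqP; rewrite mulf_eq0 expf_eq0/= invr_eq0 gt_eqF//= => /eqP.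
pose F i y := y 0 i * component j u i (x + y).
pose G i y := - component j u i x * y 0 i.
have cF i : continuous (F i).
  move=> y; have [_ cv] := cperiodic_component j i.
  have h : continuous_at y (fun y => component j u i (x + y)).
    apply: (@continuous_comp _ _ _ (fun z : E => x + z) (component j u i)); last exact: cv.
    exact: cvgD (cvg_cst _) (@cvg_id _ _).
  exact: (cvgM (@ci i y) h).
have cG i : continuous (G i).
  by move=> y; exact: (cvgM (cvg_cst (- component j u i x)) (@ci i y)).
have cFG i : continuous (fun y => F i y + G i y).
  by move=> y; exact: (cvgD (cF i y) (cG i y)).
rewrite (@eq_sint _ _ _ _ (fun y => s^-1 ^+ 2 * \sum_i (F i y + G i y))); last first.
  move=> y _; rewrite coord_symbol mulr_sumr; apply: eq_bigr => i _.
  by rewrite mxE linearZ linearZ /= linearB linearB /F /G /component; ring.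
rewrite (sintZ s_gt0); last by apply: continuous_sum => i _; exact: cFG.
congr (_ * _); rewrite (sint_sum s_gt0 xpredT cFG); apply: eq_bigr => i _.
rewrite (sintD s_gt0 (cF i) (cG i)) (sintZ s_gt0 _ (@ci i)).
by rewrite (sint_odd s_gt0 (@ci i)) ?mulr0 ?addr0// => y; rewrite mxE.
Qed.

Lemma enorm_freq m : enorm (freq m : E) = 2 * pi * enorm (map_mx intr m : E).
Proof.
apply/eqP; rewrite -(@eqrXn2 _ 2)// ?mulr_ge0 ?enorm_ge0 ?pi_ge0//.
by rewrite exprMn -!dotv_enorm /freq dotvZl dotvZr mulrA expr2.
Qed.

(** Each coordinate of the first operator is the divergence of a vector field,
    and the same coordinate of the second one is a multiple of its flux through
    spheres. *)
Theorem diff_op_spherical_op :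
  (forall m, nonzero_freq A (map_mx intr m) ->
     besselJ (d.+1%:R / 2) (2 * pi * s * enorm (map_mx intr m : E)) != 0 :> R) ->
  (forall x, diff_op A u x = 0) <-> (forall x, spherical_op A s u x = 0).
Proof.
move=> hJ.
have key j : (forall x, divergence (component j u) x = 0) <->
             (forall x, sphere_flux s (component j u) x = 0).
  apply: (divergence_sphere_flux s_gt0).
  - by move=> i; exact: cperiodic_component.
  - by move=> i x; have ? := is_derive_component j i i x; exact: ex_derive.
  - by move=> i; exact: continuous_derive_component.
  move=> m; have [mA|mA] := pselect (nonzero_freq A (map_mx intr m : E)).
    right; rewrite enorm_freq (_ : s * _ = 2 * pi * s * enorm (map_mx intr m : E)); last by ring.
    exact: hJ.
  left=> x.
  have -> : \sum_i freq m 0 i * component j u i x = coord e j (symbol A (freq m) (u x)).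
    by rewrite coord_symbol.
  have -> : symbol A (freq m) (u x) = (2 * pi) *: symbol A (map_mx intr m) (u x).
    rewrite /symbol !sum_lfunE scaler_sumr; apply: eq_bigr => i _.
    by rewrite !scale_lfunE mxE scalerA.
  suff -> : symbol A (map_mx intr m) (u x) = 0 by rewrite scaler0 linear0.
  apply/eqP; rewrite -memv0.
  move/negP: mA; rewrite -eqn0Ngt dimv_eq0 => /eqP <-.
  by rewrite memv_img// memvf.
split=> h x; [apply/spherical_op_eq0|apply/diff_op_eq0] => j.
  by apply: (key j).1 => y; move/diff_op_eq0: (h y).
by apply: (key j).2 => y; move/spherical_op_eq0: (h y).
Qed.

End vector_valued.

Unset Implicit Arguments.

Theorem proposition2p19 (R : realType) (n : nat) (hn : (0 < n)%N)
    (V W : innerProductType R) (A : 'I_n -> 'Hom(V, W))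
    (h : V -> R) (hcont : continuous h) (s : R) (s_gt0 : 0 < s)
    (hJ : forall m : 'rV[int]_n,
       nonzero_freq A (map_mx intr m) ->
       besselJ (n%:R / 2) (2 * pi * s * enorm (map_mx intr m)) != 0 :> R) :
  quasiconvex (diff_op A) h <-> quasiconvex (spherical_op A s) h.
Proof.
case: n hn A hJ => [//|d] _ A hJ.
have key u : D_sharp u ->
    (forall x, diff_op A u x = 0) <-> (forall x, spherical_op A s u x = 0).
  by move=> [su pu _]; exact: diff_op_spherical_op.
by split=> qc v u Du Au; apply: qc => //; apply/key.
Qed.
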